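(* Let $(K,v)$ be a valued field, extend $v$ to the algebraic closure $\tilde K$ of $K$, and let $K^h\subseteq \tilde K$ be the henselization of $(K,v)$ with respect to this extension. Then every element $a\in K^h\setminus K$ is weakly distinguished over $K$. In particular, the henselization $(K^h,v)$ is an immediate extension of $(K,v)$.
   Context: Valuations are Krull valuations of arbitrary rank, written additively, with $v0=\infty$; $vK$ and $Kv$ denote the value group and residue field of $v$ on $K$. The henselization $K^h$ is the decomposition field of $(K^{\mathrm{sep}}|K,v)$, i.e. the fixed field in the separable-algebraic closure $K^{\mathrm{sep}}\subseteq\tilde K$ of $\{\sigma\in \mathrm{Gal}(K^{\mathrm{sep}}|K) : v\circ\sigma=v \text{ on } K^{\mathrm{sep}}\}$. For an extension $(L|K,v)$ of valued fields and $z\in L$, put $v(z-K):=\{v(z-c)\mid c\in K\}\subseteq vL\cup\{\infty\}$. For a convex subgroup $\Delta$ of $vK$ and $\alpha\in vK$, the coset $\alpha+\Delta$ is cofinal in $v(z-K)$ if $\alpha+\Delta\subseteq v(z-K)$ and for every $\beta\in v(z-K)$ there is $\gamma\in\alpha+\Delta$ with $\beta\le\gamma$. The element $z$ is weakly distinguished over $K$ if there are a non-trivial convex subgroup $\Delta$ of $vK$ and some $\alpha\in vK$ such that $\alpha+\Delta$ is cofinal in $v(z-K)$. The extension $(L|K,v)$ is immediate if the canonical embeddings $vK\to vL$ and $Kv\to Lv$ are onto. *)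

(* Defs.v *)
From HB Require Import structures.
From mathcomp Require Import all_boot all_order all_algebra all_field.
From mathcomp Require Import generic_quotient ring_quotient.
From mathcomp Require Import boolp classical_sets.

Set Implicit Arguments.
Unset Strict Implicit.
Unset Printing Implicit Defensive.

Import Order.TTheory GRing.Theory.
Local Open Scope ring_scope.
Local Open Scope quotient_scope.

(* [Num.POrderedZmodule] alone imposes no compatibility of [<=] with [+].
   Totality is a field here, since joining [Order.Total] with [GRing.Zmodule]
   would clash with the existing hierarchy above [Num.RealDomain]. *)
HB.mixin Record isOrderedAbGroup G of Num.POrderedZmodule G := {
  oag_le_total : total (<=%R : rel G);
  oag_leD2l : forall x y z : G, x <= y -> z + x <= z + y
}.

#[short(type="orderedAbGroupType")]
HB.structure Definition OrderedAbGroup :=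
  { G of Num.POrderedZmodule G & isOrderedAbGroup G }.

Variant withInfty (G : Type) : Type := Fin of G | Infty.
Arguments Infty {G}.

Section WithInfty.
Variable G : orderedAbGroupType.

Definition infty_opt (a : withInfty G) : option G :=
  if a is Fin x then Some x else None.
Definition opt_infty (a : option G) : withInfty G :=
  if a is Some x then Fin x else Infty.

Fact infty_optK : cancel infty_opt opt_infty. Proof. by case. Qed.

HB.instance Definition _ := Choice.copy (withInfty G) (can_type infty_optK).

Implicit Types a b c : withInfty G.

Definition infty_le a b : bool :=
  match a, b with
  | _, Infty => true
  | Infty, Fin _ => false
  | Fin x, Fin y => x <= y
  end.

Definition infty_lt a b : bool := (b != a) && infty_le a b.

Fact infty_le_anti : antisymmetric infty_le.
Proof. by move=> [x|] [y|] //= /le_anti ->. Qed.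

Fact infty_le_trans : transitive infty_le.
Proof. by move=> [x|] [y|] [z|] //=; apply: le_trans. Qed.

Fact infty_le_total : total infty_le.
Proof. by move=> [x|] [y|] //=; apply: oag_le_total. Qed.

HB.instance Definition _ := @Order.isOrder.Build ring_display (withInfty G)
  infty_le infty_lt _ _ (fun _ _ => erefl) (fun _ _ => erefl)
  (fun _ _ => erefl) infty_le_anti infty_le_trans infty_le_total.

Definition infty_add a b : withInfty G :=
  if a is Fin x then if b is Fin y then Fin (x + y) else Infty else Infty.

Lemma infty_add_ge0 a b : Fin 0 <= a -> Fin 0 <= b -> Fin 0 <= infty_add a b.
Proof.
case: a b => [x|] [y|] //= x0 y0; apply: (@le_trans _ _ (Fin x)) => //.
by have := oag_leD2l _ _ x y0; rewrite addr0.
Qed.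

Lemma infty_add_gt0 a b : Fin 0 <= a -> Fin 0 < b -> Fin 0 < infty_add a b.
Proof.
move=> a0 b0; case: a a0 => [x|] // x0; apply: (lt_le_trans b0).
case: b b0 => [y|] // _; rewrite /= -[y in Fin y <= _]addr0 addrC [x + y]addrC.
by rewrite add0r; have := oag_leD2l _ _ y x0; rewrite addr0.
Qed.

End WithInfty.

Record valuation (K : fieldType) (G : orderedAbGroupType) := Valuation {
  val_fun :> K -> withInfty G;
  val_eqoo : forall x, val_fun x = Infty <-> x = 0;
  valM : forall x y, val_fun (x * y) = infty_add (val_fun x) (val_fun y);
  valD : forall x y, Order.min (val_fun x) (val_fun y) <= val_fun (x + y)
}.

Section ValuationTheory.
Variables (K : fieldType) (G : orderedAbGroupType) (v : valuation K G).

Lemma val0 : v 0 = Infty. Proof. exact/val_eqoo. Qed.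

Lemma oag_dbl0 (g : G) : g + g = 0 -> g = 0.
Proof.
move=> g2; apply: le_anti; have /orP[g_le0|g_ge0] := oag_le_total g 0.
  by rewrite g_le0 /=; have := oag_leD2l _ _ g g_le0; rewrite g2 addr0.
by rewrite g_ge0 andbT; have := oag_leD2l _ _ g g_ge0; rewrite g2 addr0.
Qed.

Lemma val1 : v 1 = Fin 0.
Proof.
have := valM v 1 1; rewrite mulr1; case E: (v 1) => [g|] /=.
  by case=> /eqP; rewrite -subr_eq0 opprD addNKr oppr_eq0 => /eqP ->.
by move/val_eqoo/eqP: E; rewrite oner_eq0.
Qed.

Lemma valN x : v (- x) = v x.
Proof.
have vN1 : v (-1) = Fin 0.
  have := valM v (-1) (-1); rewrite mulrNN mulr1 val1.
  by case: (v (-1)) => //= g [] /esym/oag_dbl0 ->.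
by rewrite -mulN1r valM vN1; case: (v x) => //= g; rewrite add0r.
Qed.

Lemma valB_ge a x y : a <= v x -> a <= v y -> a <= v (x - y).
Proof.
by move=> ax ay; apply: le_trans (valD _ _ _); rewrite le_min ax valN.
Qed.

Lemma valB_gt a x y : a < v x -> a < v y -> a < v (x - y).
Proof.
by move=> ax ay; apply: lt_le_trans (valD _ _ _); rewrite lt_min ax valN.
Qed.

Definition value_group : set G := [set g | exists x, v x = Fin g].

Definition val_ring_pred : pred K := fun x => Fin 0 <= v x.

Fact val_ring_subring : subring_closed val_ring_pred.
Proof.
split=> [|x y|x y]; rewrite /in_mem /= /val_ring_pred ?val1 //.
  exact: valB_ge.
by rewrite valM; apply: infty_add_ge0.
Qed.

HB.instance Definition _ :=
  GRing.isSubringClosed.Build K val_ring_pred val_ring_subring.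

Record val_ring := ValRing { val_ring_val : K; _ : val_ring_pred val_ring_val }.

HB.instance Definition _ := [isSub for val_ring_val].
HB.instance Definition _ := [Choice of val_ring by <:].
HB.instance Definition _ := [SubChoice_isSubComNzRing of val_ring by <:].

Definition val_ideal : {pred val_ring} := fun x => Fin 0 < v (val x).

Fact val_ideal_closed : idealr_closed val_ideal.
Proof.
split=> [||a x y]; rewrite /in_mem /= /val_ideal ?rmorph0 ?val0 //.
  by rewrite rmorph1 val1 ltxx.
move=> x0 y0; rewrite rmorphD rmorphM /= -[X in _ + X]opprK.
apply: valB_gt; last by rewrite valN.
by rewrite valM; apply: infty_add_gt0 => //; apply: valP a.
Qed.
HB.instance Definition _ := isIdealr.Build val_ring val_ideal val_ideal_closed.

Definition residue_field : Type := {ideal_quot val_ideal}.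

HB.instance Definition _ := GRing.ComNzRing.on residue_field.

Definition residue (x : val_ring) : residue_field := \pi_residue_field x.

HB.instance Definition _ := GRing.RMorphism.copy residue \pi_residue_field.

Lemma residue_eq x y : (residue x = residue y) <-> Fin 0 < v (val x - val y).
Proof.
have E : (residue x == residue y) = (Fin 0 < v (val x - val y)).
  by rewrite /residue -(Quotient.idealrBE val_ideal) -rmorphB.
by split=> [/eqP|]; [rewrite E | rewrite -E => /eqP].
Qed.

Fact residue_unit (z : residue_field) : z != 0 -> exists y, y * z = 1.
Proof.
elim/quotW: z => x; rewrite -[\pi x]/(residue x) -(rmorph0 residue) => x_neq0.
have [g vx] : exists g, v (val x) = Fin g.
  case E: (v (val x)) => [g|]; first by exists g.
  by case/eqP: x_neq0; apply/residue_eq; rewrite rmorph0 subr0 E.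
have x0 : val x != 0.
  by apply/eqP => /(val_eqoo v); rewrite vx.
have vV : v (val x)^-1 = Fin 0.
  have ge0 : Fin 0 <= v (val x) := valP x.
  have vx0 : v (val x) = Fin 0.
    apply: le_anti; rewrite ge0 andbT leNgt; apply/negP => gt0.
    by case/eqP: x_neq0; apply/residue_eq; rewrite rmorph0 subr0.
  have := valM v (val x)^-1 (val x); rewrite mulVf // val1 vx0.
  by case: (v _^-1) => //= h [->]; rewrite addr0.
have OV : val_ring_pred (val x)^-1 by rewrite /val_ring_pred vV.
exists (residue (ValRing OV)); rewrite -rmorphM -(rmorph1 residue).
by congr residue; apply: val_inj; rewrite rmorphM rmorph1 /= mulVf.
Qed.

Definition residue_inv (z : residue_field) : residue_field :=
  if pselect (exists y, y * z = 1) is left h then projT1 (cid h) else 0.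

Fact residue_mulVf z : z != 0 -> residue_inv z * z = 1.
Proof.
rewrite /residue_inv; case: pselect => [h _|h /residue_unit//].
exact: projT2 (cid h).
Qed.

Fact residue_inv0 : residue_inv 0 = 0.
Proof.
rewrite /residue_inv; case: pselect => // h; exfalso; case: h => y /eqP.
by rewrite mulr0 eq_sym oner_eq0.
Qed.

HB.instance Definition _ :=
  GRing.ComNzRing_isField.Build residue_field residue_mulVf residue_inv0.

End ValuationTheory.

Definition val_restrict (K L : fieldType) (G : orderedAbGroupType)
  (iota : {rmorphism K -> L}) (w : valuation L G) : valuation K G.
Proof.
refine (@Valuation K G (w \o iota) _ _ _) => [x|x y|x y] /=.
- rewrite val_eqoo; split=> [/eqP|->]; last exact: rmorph0.
  by rewrite fmorph_eq0 => /eqP.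
- by rewrite rmorphM valM.
- by rewrite rmorphD; apply: valD.
Defined.

Section ValuedExtension.
Variables (K L : fieldType) (G : orderedAbGroupType).
Variables (iota : {rmorphism K -> L}) (v : valuation K G) (w : valuation L G).

Definition val_extends : Prop := forall x, w (iota x) = v x.

(* v(z - K) *)
Definition val_diff (z : L) : set (withInfty G) :=
  [set w (z - iota c) | c in [set: K]].

Record convex_subgroup (D : set G) : Prop := ConvexSubgroup {
  convex_sub : (D `<=` value_group v)%classic;
  convex0 : D 0;
  convexB : forall a b, D a -> D b -> D (a - b);
  convexP : forall a b c, D a -> D c -> value_group v b -> a <= b -> b <= c ->
    D b
}.

Definition coset_cofinal (a : G) (D : set G) (S : set (withInfty G)) : Prop :=
  (forall d, D d -> S (Fin (a + d))) /\
  (forall b, S b -> exists2 d, D d & b <= Fin (a + d)).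

Definition weakly_distinguished (z : L) : Prop :=
  exists D, [/\ convex_subgroup D, exists2 d, D d & d != 0 &
    exists2 a, value_group v a & coset_cofinal a D (val_diff z)].

Hypothesis ext : val_extends.

Fact val_ring_map_subproof (x : val_ring v) : val_ring_pred w (iota (val x)).
Proof. by rewrite /val_ring_pred ext; apply: valP x. Qed.

Definition val_ring_map (x : val_ring v) : val_ring w :=
  ValRing (val_ring_map_subproof x).

(* Kv -> Lv; independent of the representative by [residue_mapE]. *)
Definition residue_map (z : residue_field v) : residue_field w :=
  residue (val_ring_map (repr z)).

Lemma residue_mapE x : residue_map (residue x) = residue (val_ring_map x).
Proof.
apply/residue_eq => /=; rewrite -rmorphB ext.
by apply/residue_eq; rewrite /residue reprK.
Qed.

(* The embedding vK -> vL is the inclusion, as both groups lie in G. *)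
Definition immediate : Prop :=
  (value_group w `<=` value_group v)%classic /\
  (forall y, exists x, residue_map x = y).

End ValuedExtension.

Lemma irreducible_root_factor (K E : fieldType) (iota : {rmorphism K -> E})
    (p : {poly K}) (x : E) : p != 0 -> root (map_poly iota p) x ->
  exists q, [/\ irreducible_poly q, root (map_poly iota q) x & q %| p].
Proof.
move=> p0 px.
pose P n := `[<exists q : {poly K},
  [/\ q != 0, root (map_poly iota q) x & size q = n]>].
have exP : exists n, P n by exists (size p); apply/asboolP; exists p.
case: (ex_minnP exP) => n /asboolP[q [q0 qx sq] minq].
have irr_q : irreducible_poly q.
  apply/(subfx_irreducibleP qx q0) => r rx r0; rewrite sq; apply: minq.
  by apply/asboolP; exists r.
exists q; split=> //; have gx : root (map_poly iota (gcdp q p)) x.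
  by rewrite gcdp_map root_gcd qx px.
have g0 : gcdp q p != 0 by rewrite gcdp_eq0 negb_and q0.
have /eqp_dvdl <- : gcdp q p %= q.
  apply: irr_q.2; last exact: dvdp_gcdl.
  by rewrite -(size_map_poly iota) gtn_eqF // (root_size_gt1 _ gx) ?map_poly_eq0.
exact: dvdp_gcdr.
Qed.

Section SeparableClosure.
Variables (K E : fieldType) (iota : {rmorphism K -> E}).

Local Notation "p ^iota" := (map_poly iota p)
  (at level 2, format "p ^iota") : ring_scope.

(* Up to a scalar, p is the minimal polynomial of x over K. *)
Definition separable_over (x : E) : Prop :=
  exists p : {poly K}, [/\ irreducible_poly p, root p^iota x & separable_poly p].

Lemma separable_overP (x : E) : separable_over x <->
  exists2 p : {poly K}, separable_poly p & root p^iota x.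
Proof.
split=> [[p [_ px sp]]|[p sp px]]; first by exists p.
have [q [irr_q qx qp]] := irreducible_root_factor (separable_poly_neq0 sp) px.
by exists q; split=> //; apply: dvdp_separable sp.
Qed.

Lemma separable_over_base (c : K) : separable_over (iota c).
Proof.
apply/separable_overP; exists ('X - c%:P); last first.
  by rewrite map_polyXsubC root_XsubC.
by have := separable_prod_XsubC [:: c]; rewrite big_seq1.
Qed.

Lemma separable_over_common (x y : E) : separable_over x -> separable_over y ->
  exists (L : fieldExtType K) (f : {rmorphism L -> E}) (x' y' : L),
    [/\ forall c, f c%:A = iota c, f x' = x, f y' = y,
       separable_element 1 x' & separable_element 1 y'].
Proof.
move=> [p [irr_p px sep_p]] [q [irr_q qy sep_q]].
pose L1 : fieldExtType K := SubFieldExtType px irr_p.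
pose f1 : {rmorphism L1 -> E} := @subfx_inj _ _ iota x p.
have f1c c : f1 c%:A = iota c by apply: subfx_inj_base px (irredp_neq0 irr_p) _.
have sepL (F0 : fieldExtType K) (f : {rmorphism F0 -> E}) (r : {poly K}) z :
    (forall c, f c%:A = iota c) -> separable_poly r -> root r^iota (f z) ->
    separable_element 1 z.
  move=> fc sep_r rz; apply/separable_elementP; exists (map_poly (in_alg F0) r).
  split; last by rewrite separable_map.
    by apply/polyOver1P; exists r.
  rewrite -(fmorph_root f) -map_poly_comp (eq_map_poly (g := iota)) //.
have q1y : root (map_poly f1 (map_poly (in_alg L1) q)) y.
  by rewrite -map_poly_comp (eq_map_poly (g := iota)).
have q1_0 : map_poly (in_alg L1) q != 0 by rewrite map_poly_eq0 irredp_neq0.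
have [r [irr_r ry _]] := irreducible_root_factor q1_0 q1y.
pose L2 : fieldExtType L1 := SubFieldExtType ry irr_r.
pose f2 : {rmorphism L2 -> E} := @subfx_inj _ _ f1 y r.
have f2c c : f2 c%:A = f1 c by apply: subfx_inj_base ry (irredp_neq0 irr_r) _.
have f1x : f1 (subfx_root iota x p) = x by apply: subfx_inj_root (irredp_neq0 _).
have f2y : f2 (subfx_root f1 y r) = y by apply: subfx_inj_root (irredp_neq0 _).
pose f : {rmorphism baseFieldType L2 -> E} := f2.
have fc c : f c%:A = iota c by rewrite baseField_scaleE /= /f f2c f1c.
exists (baseFieldType L2), f, (in_alg L2 (subfx_root iota x p)), (subfx_root f1 y r).
split=> //; first by rewrite /f /= f2c.
  by apply: (sepL _ f p) => //; rewrite /f /= f2c f1x.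
by apply: (sepL _ f q) => //; rewrite /f f2y.
Qed.

Lemma separable_over_closed (P : E -> E -> E) :
    (forall (L : fieldExtType K) (f : {rmorphism L -> E}) (F : {subfield L}) x y,
       x \in F -> y \in F -> exists2 z, z \in F & f z = P (f x) (f y)) ->
  forall x y, separable_over x -> separable_over y -> separable_over (P x y).
Proof.
move=> closedP x y sx sy.
have [L [f [x' [y' [fc <- <- sx' sy']]]]] := separable_over_common sx sy.
have xF : x' \in <<1 & [:: x'; y']>>%VS by apply: seqv_sub_adjoin; rewrite !inE eqxx.
have yF : y' \in <<1 & [:: x'; y']>>%VS.
  by apply: seqv_sub_adjoin; rewrite !inE eqxx orbT.
have [z zF <-] := closedP L f _ _ _ xF yF.
have : separable 1 <<1 & [:: x'; y']>>.
  by apply: separable_Fadjoin_seq; rewrite /= sx' sy'.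
move=> /separableP/(_ z zF)/separable_elementP[p [/polyOver1P[q ->]]].
rewrite separable_map -(fmorph_root f) -map_poly_comp.
rewrite (eq_map_poly (g := iota)) // => qz sep_q.
by apply/separable_overP; exists q.
Qed.

Definition sep_pred : {pred E} := fun x => `[<separable_over x>].

Fact sep_divring : divring_closed sep_pred.
Proof.
split=> [|x y /asboolP sx /asboolP sy|x y /asboolP sx /asboolP sy].
- by apply/asboolP; rewrite -(rmorph1 iota); apply: separable_over_base.
- apply/asboolP; apply: (separable_over_closed (P := fun x y => x - y)) => //.
  by move=> L f F a b aF bF; exists (a - b); rewrite ?rpredB ?rmorphB.
- apply/asboolP; apply: (separable_over_closed (P := fun x y => x / y)) => //.
  by move=> L f F a b aF bF; exists (a / b); rewrite ?rpred_div ?fmorph_div.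
Qed.

HB.instance Definition _ := GRing.isDivringClosed.Build E sep_pred sep_divring.

Record sep_closure := SepClosure { sep_val : E; _ : sep_pred sep_val }.

HB.instance Definition _ := [isSub for sep_val].
HB.instance Definition _ := [Choice of sep_closure by <:].
HB.instance Definition _ := [SubChoice_isSubIntegralDomain of sep_closure by <:].
HB.instance Definition _ :=
  [SubIntegralDomain_isSubField of sep_closure by <:].

Fact sep_base_subproof (c : K) : sep_pred (iota c).
Proof. by apply/asboolP/separable_over_base. Qed.

Definition sep_base (c : K) : sep_closure := SepClosure (sep_base_subproof c).

Fact sep_base_zmod : zmod_morphism sep_base.
Proof. by move=> c d; apply: val_inj; rewrite /= rmorphB. Qed.
Fact sep_base_monoid : monoid_morphism sep_base.
Proof.
by split=> [|c d]; apply: val_inj; rewrite /= ?rmorph1 ?rmorphM.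
Qed.
HB.instance Definition _ :=
  GRing.isZmodMorphism.Build K sep_closure sep_base sep_base_zmod.
HB.instance Definition _ :=
  GRing.isMonoidMorphism.Build K sep_closure sep_base sep_base_monoid.

Definition sep_galois (s : {rmorphism sep_closure -> sep_closure}) : Prop :=
  bijective s /\ forall c, s (sep_base c) = sep_base c.

End SeparableClosure.

Section Henselization.
Variables (K E : fieldType) (iota : {rmorphism K -> E}).
Variables (G : orderedAbGroupType) (w : valuation E G).

Local Notation Ksep := (sep_closure iota).

Definition decomposition (s : {rmorphism Ksep -> Ksep}) : Prop :=
  sep_galois s /\ forall x, w (val (s x)) = w (val x).

Definition hens_pred : {pred Ksep} :=
  fun x => `[<forall s, decomposition s -> s x = x>].

Fact hens_divring : divring_closed hens_pred.
Proof.
split=> [|x y /asboolP hx /asboolP hy|x y /asboolP hx /asboolP hy];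
  apply/asboolP => s ds.
- exact: rmorph1.
- by rewrite rmorphB hx ?hy.
- by rewrite fmorph_div hx ?hy.
Qed.

HB.instance Definition _ := GRing.isDivringClosed.Build Ksep hens_pred hens_divring.

Record henselization := Henselization {
  hens_sep : Ksep;
  _ : hens_pred hens_sep
}.

HB.instance Definition _ := [isSub for hens_sep].
HB.instance Definition _ := [Choice of henselization by <:].
HB.instance Definition _ :=
  [SubChoice_isSubIntegralDomain of henselization by <:].
HB.instance Definition _ :=
  [SubIntegralDomain_isSubField of henselization by <:].

Fact hens_base_subproof (c : K) : hens_pred (sep_base iota c).
Proof. by apply/asboolP => s [[_ sK] _]. Qed.

Definition hens_base (c : K) : henselization :=
  Henselization (hens_base_subproof c).

Fact hens_base_zmod : zmod_morphism hens_base.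
Proof. by move=> c d; apply: val_inj; rewrite /= rmorphB. Qed.
Fact hens_base_monoid : monoid_morphism hens_base.
Proof.
by split=> [|c d]; apply: val_inj; rewrite /= ?rmorph1 ?rmorphM.
Qed.
HB.instance Definition _ :=
  GRing.isZmodMorphism.Build K henselization hens_base hens_base_zmod.
HB.instance Definition _ :=
  GRing.isMonoidMorphism.Build K henselization hens_base hens_base_monoid.

Definition hens_incl : henselization -> E :=
  (val : Ksep -> E) \o (val : henselization -> Ksep).
HB.instance Definition _ := GRing.RMorphism.on hens_incl.

Definition hens_val : valuation henselization G := val_restrict hens_incl w.

Lemma hens_val_extends (v : valuation K G) :
  val_extends iota v w -> val_extends hens_base v hens_val.
Proof. by move=> ext x; apply: ext. Qed.

End Henselization.

(* Main.v *)
Require Import Defs.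
From mathcomp Require Import all_boot all_order all_algebra all_field.
From HB Require Import structures.
From mathcomp Require Import boolp classical_sets ring.

(** The proof replaces cosets of convex subgroups by a condition on elements.
Call z quadratically approximable over K ([newton_approx]) if, once z - c is
of value larger than w d, some c' in K makes w (z - c') at least
2 w (z - c) - w d. This is what Newton's iteration achieves. If z is not in K,
then the excesses w (z - c) - w d that are positive form a set which is closed
under doubling up to larger elements, hence they are cofinal in a nontrivial
convex subgroup, and z is weakly distinguished
([newton_weakly_distinguished]). In particular no element of K is a best
approximation of z, and immediacy follows.

Being quadratically approximable is transitive in towers ([newton_trans]). So
take a maximal subring F of the algebraic closure that contains K and consists
of quadratically approximable elements; it is a field. The theorem follows from
K^h being contained in F, which has two parts.

First, F is henselian: if a polynomial q over F has exactly one root u in a ball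
with center in F, then u is in F ([maximal_newton_field]). Otherwise choose such
q of least degree. Newton's iteration with q shows that u is quadratically
approximable over F. Division with remainder and the minimality of q show that
a nonzero polynomial h of smaller degree has no root which is closer to u than
all elements of F ([isolated_no_near]), so that w (h(c)) = w (h(u)) as soon as
c in F is close to u. Hence no element of F approximates g(u) better than all
the g(c) do, and w (g(u) - g(c)) is w (A (u - c)^N) for constants A and N;
therefore all elements of F[u] inherit quadratic approximability from u
([isolated_adjoin_newton]). By transitivity this contradicts the maximality
of F.

Second, over a henselian F every automorphism of the algebraic closure preserves
the values of separable elements ([henselian_val]). Suppose that w x < w (s x).
Let I be the set of conjugates of x of value at most w x. Then the product over
I has smaller value than the product over any other set of as many conjugates.
So it is the only root, in a suitable ball, of the polynomial whose roots are
all these products. This polynomial is Galois invariant, so its coefficients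
lie in F, and so does the product over I; but s moves I. Consequently all
automorphisms over F induce elements of the decomposition group and fix K^h,
whereas separable elements outside F are moved ([separable_fixed]). *)

Set Implicit Arguments.
Unset Strict Implicit.
Unset Printing Implicit Defensive.

Import Order.TTheory GRing.Theory.
Local Open Scope ring_scope.

(** * Values of elements *)

Section ValuationInequalities.
Variables (E : fieldType) (G : orderedAbGroupType) (w : valuation E G).
Implicit Types x y z t : E.

Lemma val_lt_neq0 x y : w x < w y -> x != 0.
Proof.
by move=> lt_xy; apply/eqP => x0; move: lt_xy; rewrite x0 val0; case: (w y).
Qed.

Lemma val_le0 x : w x <= w 0. Proof. by rewrite val0; case: (w x). Qed.

Lemma val_lt0 x : x != 0 -> w x < w 0.
Proof.
move=> x0; rewrite lt_neqAle val_le0 andbT val0.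
by apply/eqP => /val_eqoo/eqP; rewrite (negPf x0).
Qed.

Lemma val_fin x : x != 0 -> exists g, w x = Fin g.
Proof.
move=> x0; case wx: (w x) => [g|]; first by exists g.
by move/val_eqoo/eqP: wx; rewrite (negPf x0).
Qed.

Lemma valBC x y : w (x - y) = w (y - x). Proof. by rewrite -opprB valN. Qed.

Lemma valD_ge t x y : w t <= w x -> w t <= w y -> w t <= w (x + y).
Proof. by move=> tx ty; rewrite -[y]opprK; apply: valB_ge; rewrite ?valN. Qed.

Lemma valD_lt x y : w x < w y -> w (x + y) = w x.
Proof.
move=> lt_xy; apply/le_anti/andP; split; last exact: valD_ge (ltW lt_xy).
rewrite leNgt; apply/negP => lt_x.
by have := valB_gt lt_x lt_xy; rewrite addrK ltxx.
Qed.

(** Two points of a ball are equidistant from a point outside of it. *)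
Lemma val_swap x y z : w (x - y) < w (x - z) -> w (z - y) = w (x - y).
Proof.
move=> lt_z; have -> : z - y = (x - y) + (z - x) by rewrite [RHS]addrC subrKA.
by rewrite valD_lt // [w (z - x)]valBC.
Qed.

Lemma val_mul2l_le z x y : w x <= w y -> w (z * x) <= w (z * y).
Proof.
rewrite !Defs.valM; case: (w z) (w x) (w y) => [c|] [a|] [b|] //= ab.
exact: oag_leD2l.
Qed.

Lemma ler_val2l z x y : z != 0 -> (w (z * x) <= w (z * y)) = (w x <= w y).
Proof.
move=> z0; apply/idP/idP; last exact: val_mul2l_le.
by move/(val_mul2l_le z^-1); rewrite !mulKf.
Qed.

Lemma ltr_val2l z x y : z != 0 -> (w (z * x) < w (z * y)) = (w x < w y).
Proof. by move=> z0; rewrite !ltNge ler_val2l. Qed.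

Lemma ler_val2r z x y : z != 0 -> (w (x * z) <= w (y * z)) = (w x <= w y).
Proof. by rewrite ![_ * z]mulrC; apply: ler_val2l. Qed.

Lemma ltr_val2r z x y : z != 0 -> (w (x * z) < w (y * z)) = (w x < w y).
Proof. by rewrite ![_ * z]mulrC; apply: ltr_val2l. Qed.

Lemma ler_valM x y z t : w x <= w y -> w z <= w t -> w (x * z) <= w (y * t).
Proof.
move=> xy zt; apply: (@le_trans _ _ (w (x * t))); first exact: val_mul2l_le.
by rewrite ![_ * t]mulrC; apply: val_mul2l_le.
Qed.

Lemma ltr_leM x y z t : w x < w y -> w z <= w t -> z != 0 ->
  w (x * z) < w (y * t).
Proof.
move=> xy zt z0; apply: (@lt_le_trans _ _ (w (y * z))); first
  by rewrite ltr_val2r.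
exact: val_mul2l_le.
Qed.

Lemma eqr_valM x y z t : w x = w y -> w z = w t -> w (x * z) = w (y * t).
Proof. by move=> xy zt; rewrite !Defs.valM xy zt. Qed.

Lemma ler_valX n x y : w x <= w y -> w (x ^+ n) <= w (y ^+ n).
Proof.
by move=> xy; elim: n => [|n IHn]; rewrite ?expr0 // !exprS; apply: ler_valM.
Qed.

Lemma ltr_valX n x y : (0 < n)%N -> w x < w y -> w (x ^+ n) < w (y ^+ n).
Proof.
case: n => // n _ xy; rewrite !exprS; apply: ltr_leM => //.
  exact/ler_valX/ltW.
by rewrite expf_neq0 // (val_lt_neq0 xy).
Qed.

End ValuationInequalities.

(** * Quadratic approximation *)

Section NewtonElements.
Variables (E : fieldType) (G : orderedAbGroupType) (w : valuation E G).
Variables (F : fieldType) (j : {rmorphism F -> E}).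
Implicit Types (z : E) (c : F).

(** Additively: w (z - c') >= 2 w (z - c) - w d, the quality of a Newton step.
The condition is stated multiplicatively so that only values of elements of E
are compared. *)
Definition newton_approx z : Prop := exists d : E,
  (exists c, w d < w (z - j c)) /\
  (forall c, w d < w (z - j c) ->
     exists c', w ((z - j c) ^+ 2) <= w (d * (z - j c'))).

Definition no_best_approx z : Prop :=
  forall c, exists c', w (z - j c) < w (z - j c').

Lemma newton_approx_base c : newton_approx (j c).
Proof.
exists 1; split; first by exists c; rewrite subrr val_lt0 // oner_neq0.
by move=> c' _; exists c; rewrite subrr mulr0 val_le0.
Qed.

Lemma newton_no_best z : (forall c, z <> j c) -> newton_approx z ->
  no_best_approx z.
Proof.
move=> zF [d [[c0 dc0] step]] c.
have [dc|cd] := ltP (w d) (w (z - j c)); last first.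
  by exists c0; apply: le_lt_trans dc0.
have zc : z - j c != 0 by rewrite subr_eq0; apply/eqP/zF.
have [c' le_c'] := step c dc; exists c'.
rewrite -(ltr_val2l _ _ _ (val_lt_neq0 dc0)); apply: lt_le_trans le_c'.
by rewrite expr2 ltr_val2r.
Qed.

End NewtonElements.

(** If some c in F is closer to z than to all of K, then z and c have the same
distances to K. Otherwise elements of K approximate z as well as those of F do.
*)
Lemma newton_trans (E : fieldType) (G : orderedAbGroupType) (w : valuation E G)
    (K F : fieldType) (i : {rmorphism K -> E}) (j : {rmorphism F -> E}) (z : E) :
    (forall k, exists c, i k = j c) -> (forall c, newton_approx w i (j c)) ->
  newton_approx w j z -> newton_approx w i z.
Proof.
move=> KF newtonF newtonz.
have [[c far]|near] :=
  pselect (exists c, forall k, w (j c - i k) < w (z - j c)).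
  have eqw k : w (z - i k) = w (j c - i k).
    by rewrite (val_swap (x := j c)) // [w (j c - z)]valBC.
  have [d [[k dk] step]] := newtonF c; exists d; split.
    by exists k; rewrite eqw.
  move=> k1; rewrite eqw => /step[k2 le12]; exists k2.
  rewrite expr2 Defs.valM !eqw -Defs.valM -expr2 (le_trans le12) //.
  by rewrite !Defs.valM eqw.
have approx c : exists k, w (z - j c) <= w (z - i k).
  have [//|none] := pselect (exists k, w (z - j c) <= w (z - i k)).
  case: near; exists c => k; rewrite ltNge; apply/negP => le_k; case: none.
  by exists k; rewrite -(subrKA (j c) z (- i k)); apply: valD_ge.
have [d [[c0 dc0] step]] := newtonz; exists d; split.
  by have [k /(lt_le_trans dc0)] := approx c0; exists k.
move=> k dk; have [c ik] := KF k; move: dk; rewrite ik => /step[c' le_c'].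
have [k' le_k'] := approx c'; exists k'.
by apply: le_trans le_c' _; apply: val_mul2l_le.
Qed.

Section Near.
Variables (E : fieldType) (G : orderedAbGroupType) (w : valuation E G).
Variables (F : fieldType) (j : {rmorphism F -> E}) (u : E).
Hypothesis no_best : no_best_approx w j u.
Implicit Types (r : E) (c : F) (P Q : {poly E}).

(** These are the points r that F cannot separate from u. *)
Definition near r : bool := `[<forall c, w (u - j c) < w (u - r)>].

Lemma subu_neq0 c : u - j c != 0.
Proof. by have [c'] := no_best c; apply: val_lt_neq0. Qed.

Lemma near_self : near u.
Proof. by apply/asboolP => c; rewrite subrr val_lt0 ?subu_neq0. Qed.

Lemma near_notin c : ~~ near (j c).
Proof. by apply/asboolPn => /(_ c); rewrite ltxx. Qed.

Definition closer c1 c2 := w (u - j c1) <= w (u - j c2).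

Lemma closer_max c1 c2 : exists c, closer c1 c /\ closer c2 c.
Proof.
rewrite /closer; have [le12|/ltW le21] := leP (w (u - j c1)) (w (u - j c2)).
  by exists c2.
by exists c1.
Qed.

Lemma closer_far (rs : seq E) :
  exists c1, forall r, r \in rs -> ~~ near r -> w (u - r) < w (u - j c1).
Proof.
elim: rs => [|r rs [c1 IHrs]]; first by exists 0.
have [nr|/asboolPn far] := boolP (near r).
  by exists c1 => s; rewrite inE => /predU1P[->|/IHrs //]; rewrite nr.
have [c2 c2r] : exists c2, w (u - r) <= w (u - j c2).
  have [//|none] := pselect (exists c2, w (u - r) <= w (u - j c2)).
  by case: far => c; rewrite ltNge; apply/negP => le_c; case: none; exists c.
have [c3 [c13 c23]] := closer_max c1 c2; have [c4 c34] := no_best c3.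
exists c4 => s; rewrite inE => /predU1P[->|s_rs] farS; apply: le_lt_trans c34.
  exact: le_trans c2r c23.
exact: ltW (lt_le_trans (IHrs s s_rs farS) c13).
Qed.

(** For c close to u, the value of P(c) is an affine function of w (u - c) of
slope N; below, N is the number of near roots of P. The value of P(u) is the
constant value if N = 0 and exceeds all the values otherwise. *)
Definition eventual_order P N := exists c1 A, A != 0 /\ forall c, closer c1 c ->
  w P.[j c] = w (A * (u - j c) ^+ N) /\
  (if N is 0 then w P.[u] = w P.[j c] else w P.[j c] < w P.[u]).

Lemma eventual_le P N c1 A : A != 0 -> (forall c, closer c1 c ->
  w P.[j c] = w (A * (u - j c) ^+ N) /\
  (if N is 0 then w P.[u] = w P.[j c] else w P.[j c] < w P.[u])) ->
  forall c, closer c1 c -> P.[j c] != 0 /\ w P.[j c] <= w P.[u].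
Proof.
move=> A0 ev c /ev[wP le_P]; split; last by case: N le_P {wP ev} => [->|n /ltW].
apply/eqP => P0; move: wP; rewrite P0 val0 => /esym/val_eqoo/eqP.
by rewrite mulf_eq0 expf_eq0 (negPf A0) (negPf (subu_neq0 c)) andbF.
Qed.

(** A near root r contributes w (c - r) = w (u - c), whereas for the other roots
w (c - r) = w (u - r) is eventually constant. *)
Lemma eventual_prod a rs : a != 0 ->
  eventual_order (a *: \prod_(r <- rs) ('X - r%:P)) (count near rs).
Proof.
move=> a0; elim: rs => [|r rs [c1 [A [A0 IHrs]]]].
  by exists 0, a; split=> // c _; rewrite big_nil !hornerZ !hornerC expr0 mulr1.
have evE := eventual_le A0 IHrs.
have HE x : (a *: \prod_(r <- r :: rs) ('X - r%:P)).[x] =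
    (x - r) * (a *: \prod_(r <- rs) ('X - r%:P)).[x].
  by rewrite big_cons scalerAr hornerM !hornerE.
move: IHrs evE HE; set P := a *: _; set P' := a *: _ => IHrs evE HE.
have [nr|far] := boolP (near r).
  exists c1, A; split=> // c c1c; rewrite !HE /= nr /=.
  have [wP le_P] := IHrs c c1c; have [P0 le_Pu] := evE c c1c.
  have ltr : w (u - j c) < w (u - r) by move/asboolP: nr.
  have wr : w (j c - r) = w (u - j c).
    by rewrite [w (j c - r)]valBC; apply: val_swap ltr.
  split; last by apply: ltr_leM => //; rewrite wr.
  by rewrite exprS mulrCA; apply: eqr_valM.
have [c2 c2r] := closer_far [:: r].
have {}c2r := c2r r (mem_head _ _) far.
have [c3 [c13 c23]] := closer_max c1 c2.
exists c3, ((u - r) * A); split.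
  by rewrite mulf_neq0 //; apply: val_lt_neq0 c2r.
move=> c c3c; rewrite !HE /= (negPf far) add0n.
have [wP le_P] := IHrs c (le_trans c13 c3c).
have [P0 _] := evE c (le_trans c13 c3c).
have wr : w (j c - r) = w (u - r).
  by apply: val_swap; apply: lt_le_trans c2r _; apply: le_trans c23 c3c.
split; first by rewrite -mulrA; apply: eqr_valM.
case: (count _ _) le_P => [|n] le_P; first exact: eqr_valM.
rewrite ![_ * P.[_]]mulrC; apply: ltr_leM => //; first by rewrite wr.
by apply: (val_lt_neq0 (w := w) (y := u - j c2)); rewrite wr.
Qed.

(** As w (u - c) takes at least two values, the slope is determined. *)
Lemma eventual_order_uniq N M A B c1 : A != 0 -> B != 0 ->
  (forall c, closer c1 c ->
     w (A * (u - j c) ^+ N) = w (B * (u - j c) ^+ M)) -> N = M.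
Proof.
wlog ltNM : N M A B / (N < M)%N => [IH A0 B0 eqw|A0 B0 eqw].
  case: (ltngtP N M) => // lt; first exact: IH lt A0 B0 eqw.
  by apply/esym/(IH _ _ _ _ lt B0 A0) => c /eqw.
have [c2 lt12] := no_best c1.
have cancelN c : closer c1 c -> w A = w (B * (u - j c) ^+ (M - N)).
  move=> /eqw/eqP; rewrite -{1}(subnK (ltnW ltNM)) exprD mulrA eq_le.
  by rewrite !ler_val2r ?expf_neq0 ?subu_neq0 // => /le_anti.
have := cancelN c2 (ltW lt12); rewrite (cancelN c1 (lexx _)) => /eqP.
by rewrite lt_eqF // ltr_val2l // ltr_valX // subn_gt0.
Qed.

End Near.

Lemma eventual_poly (E : closedFieldType) (G : orderedAbGroupType)
    (w : valuation E G) (F : fieldType) (j : {rmorphism F -> E}) (u : E)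
    (P : {poly E}) : no_best_approx w j u -> P != 0 ->
  exists rs, P = lead_coef P *: \prod_(r <- rs) ('X - r%:P) /\
    eventual_order w j u P (count (near w j u) rs).
Proof.
move=> no_best P0; have [rs PE] := closed_field_poly_normal P.
exists rs; split=> //.
by rewrite PE; apply: eventual_prod; rewrite ?lead_coef_eq0.
Qed.

(** * Isolated roots of polynomials *)

Section Isolated.
Variables (E : closedFieldType) (G : orderedAbGroupType) (w : valuation E G).
Variables (F : fieldType) (j : {rmorphism F -> E}).
Implicit Types (q h : {poly F}) (u : E).

Local Notation "p ^j" := (map_poly j p) (at level 2, format "p ^j").

(** The open ball of center c0 and radius w d contains u but no other root of q,
and u is a simple root. *)
Definition isolated_root q u := exists a rs c0 d,
  [/\ a != 0, q^j = a *: \prod_(r <- u :: rs) ('X - r%:P),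
      w d < w (u - j c0) & forall r, r \in rs -> w (r - j c0) <= w d].

(** The logarithmic derivative is the sum of the 1 / (x - r), which have value
at least - w d. *)
Lemma deriv_prod_bound (rs : seq E) (x d : E) :
    (forall r, r \in rs -> w (x - r) <= w d) ->
  w (\prod_(r <- rs) ('X - r%:P)).[x] <=
    w ((\prod_(r <- rs) ('X - r%:P))^`().[x] * d).
Proof.
elim: rs => [|r rs IHrs] far.
  by rewrite big_nil derivC horner0 mul0r val_le0.
rewrite !big_cons derivM derivXsubC mul1r hornerD !hornerM hornerXsubC.
rewrite [X in _ <= w X]mulrDl.
apply: valD_ge; last first.
  rewrite -mulrA; apply/val_mul2l_le/IHrs => s s_rs.
  by rewrite far ?inE ?s_rs ?orbT.
by rewrite mulrC; apply/val_mul2l_le/far/mem_head.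
Qed.

(** One step of Newton's iteration. Write q = a (X - u) Q; as w (c - r) <= w d
for all roots r of Q, the value of Q'(c) / Q(c) is at least - w d. *)
Lemma isolated_newton q u : (forall c, u <> j c) -> isolated_root q u ->
  newton_approx w j u.
Proof.
move=> uF [a [rs [c0 [d [a0 qE uc0 far]]]]].
exists d; split=> [|c dc]; first by exists c0.
have {}far r : r \in rs -> w (r - j c) <= w d.
  move=> r_rs; rewrite leNgt; apply/negP => lt_dr; have := far r r_rs.
  have -> : r - j c0 = (r - j c) - ((u - j c) - (u - j c0)).
    by ring.
  by rewrite leNgt => /negP[]; do 2!apply: valB_gt => //.
set Q := \prod_(r <- rs) ('X - r%:P).
set t := u - j c in dc *; set Qc := Q.[j c]; set D := Q^`().[j c].
have QD : w Qc <= w (D * d).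
  by apply: deriv_prod_bound => r /far; rewrite [w (j c - r)]valBC.
have Qc0 : Qc != 0.
  rewrite -rootE root_prod_XsubC; apply/negP => /far.
  rewrite subrr leNgt => /negP[].
  exact: lt_le_trans dc (val_le0 _ _).
have d0 : d != 0 := val_lt_neq0 dc.
have ltQ : w Qc < w (t * D).
  by rewrite -(ltr_val2l _ _ _ d0) mulrCA [d * D]mulrC; apply: ltr_leM.
have wQ : w (Qc - t * D) = w Qc by rewrite valD_lt // valN.
have q1 : j q.[c] = - a * t * Qc.
  rewrite -horner_map qE big_cons hornerZ hornerM hornerXsubC -/Q -/Qc.
  by rewrite mulNr -mulrN /t opprB mulrA.
have q2 : j q^`().[c] = a * (Qc - t * D).
  rewrite -horner_map -deriv_map qE big_cons derivZ derivM derivXsubC mul1r.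
  by rewrite hornerZ hornerD hornerM hornerXsubC -/Q -/Qc -/D -mulNr /t opprB.
have QtD0 : Qc - t * D != 0.
  by apply: (val_lt_neq0 (w := w) (y := t * D)); rewrite wQ.
exists (c - q.[c] / q^`().[c]).
(* With t = u - c the new error is - t^2 Q'(c) / (Q(c) - t Q'(c)). *)
have -> : u - j (c - q.[c] / q^`().[c]) = - (t ^+ 2 * D) / (Qc - t * D).
  rewrite rmorphB fmorph_div q1 q2 opprB addrCA -/t.
  by field; rewrite QtD0.
rewrite -(ler_val2r _ _ _ QtD0) mulrA mulfVK //.
rewrite mulrN valN mulrCA; apply: ler_valM => //.
by rewrite wQ mulrC.
Qed.

Lemma isolated_far u a rs c0 d q : a != 0 -> no_best_approx w j u ->
  q^j = a *: \prod_(r <- u :: rs) ('X - r%:P) ->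
  w d < w (u - j c0) -> (forall r, r \in rs -> w (r - j c0) <= w d) ->
  eventual_order w j u q^j 1.
Proof.
move=> a0 no_best qE dc0 far; rewrite qE.
have <- : count (near w j u) (u :: rs) = 1%N; last exact: eventual_prod.
rewrite /= (near_self no_best) (eqP (_ : count _ rs == 0%N)) //.
rewrite eqn0Ngt -has_count.
apply/hasPn => r /far le_rd; apply/asboolP => /(_ c0) ltr.
by move: le_rd; rewrite (val_swap ltr) leNgt dc0.
Qed.

(** The ball around u that excludes the roots which are not near has its center
in F, because elements of F come strictly closer to u than these roots do. *)
Lemma isolated_of_count u h rs : h != 0 -> no_best_approx w j u ->
    h^j = lead_coef h^j *: \prod_(r <- rs) ('X - r%:P) ->
    count (near w j u) rs = 1%N ->
  exists2 v, near w j u v & isolated_root h v.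
Proof.
move=> h0 no_best hE cnt.
have /hasP[v v_rs nv] : has (near w j u) rs by rewrite has_count cnt.
exists v => //; have perm_rs := perm_to_rem v_rs.
have far r : r \in rem v rs -> ~~ near w j u r.
  move=> r_rs; apply/negP => nr; have := permP perm_rs (near w j u).
  rewrite cnt /= nv => -[] /esym/eqP; rewrite eqn0Ngt -has_count => /hasP[].
  by exists r.
have [c1 c1r] := closer_far no_best (rem v rs); have [c2 c12] := no_best c1.
exists (lead_coef h^j), (rem v rs), c2, (u - j c1); split.
- by rewrite lead_coef_eq0 map_poly_eq0.
- by rewrite {1}hE; congr (_ *: _); apply: perm_big.
- rewrite (_ : v - j c2 = (u - j c2) - (u - v)); last by ring.
  by apply: valB_gt => //; move/asboolP: nv; apply.
- move=> r r_rs; have ltr := c1r r r_rs (far r r_rs).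
  have -> : w (r - j c2) = w (u - r); last exact: ltW.
  by rewrite [w (r - j c2)]valBC; apply: val_swap (lt_trans ltr c12).
Qed.

Section MinimalDegree.
Variables (q : {poly F}) (u : E).
Hypothesis uF : forall c, u <> j c.
Hypothesis iso : isolated_root q u.
Hypothesis minq :
  forall h v, (size h < size q)%N -> isolated_root h v -> exists c, v = j c.

Let newton_u := isolated_newton uF iso.
Let no_best := newton_no_best uF newton_u.

Lemma isolated_root_eq0 : q^j.[u] = 0.
Proof.
have [a [rs [c0 [d [a0 qE _ _]]]]] := iso.
by rewrite qE big_cons hornerZ hornerM hornerXsubC subrr mul0r mulr0.
Qed.

Lemma isolated_neq0 : q != 0.
Proof.
have [a [rs [c0 [d [a0 qE _ _]]]]] := iso.
rewrite -(map_poly_eq0 j) qE scaler_eq0 (negPf a0) /=.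
by rewrite monic_neq0 // monic_prod_XsubC.
Qed.

(** Take h of least degree with a near root and divide: q = s h + m. As m has no
near root and m(u) = - s(u) h(u), the value of m(c) is that of s(u) h(u), larger
than that of s(c) h(c); so q and s h have the same slope. Since q has slope 1, h
has exactly one near root. This root is isolated, so it lies in F by minimality
of q, but elements of F are not near. *)
Lemma isolated_no_near h r : h != 0 -> (size h < size q)%N ->
  near w j u r -> ~~ root h^j r.
Proof.
have [n] := ubnP (size h); elim: n h r => // n IHn h r lt_hn h0 lt_hq nr.
apply/negP => hr.
have [a [rsq [c0 [d [a0 qE dc0 far]]]]] := iso.
have [cq [Aq [Aq0 evq]]] := isolated_far a0 no_best qE dc0 far.
have hj0 : h^j != 0 by rewrite map_poly_eq0.
have [rsh [hE [ch [Ah [Ah0 evh]]]]] := eventual_poly no_best hj0.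
have hevE := eventual_le no_best Ah0 evh.
have cnt_h : (0 < count (near w j u) rsh)%N.
  rewrite -has_count; apply/hasP; exists r => //.
  by move: hr; rewrite hE rootZ ?root_prod_XsubC // lead_coef_eq0.
pose s := q %/ h; pose m := q %% h.
have qsm : q^j = s^j * h^j + m^j by rewrite -rmorphM -rmorphD -divp_eq.
have s0 : s != 0.
  by rewrite divp_eq0 (negPf h0) (negPf isolated_neq0) -leqNgt ltnW.
have sj0 : s^j != 0 by rewrite map_poly_eq0.
have [rss [sE [cs [As [As0 evs]]]]] := eventual_poly no_best sj0.
have sevE := eventual_le no_best As0 evs.
have [cm evm] : exists cm, forall c,
    closer w j u cm c -> w m^j.[j c] = w m^j.[u].
  have [->|m0] := eqVneq m 0.
    by exists 0 => c _; rewrite rmorph0 !horner0.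
  have mj0 : m^j != 0 by rewrite map_poly_eq0.
  have [rsm [mE [cm [Am [Am0 evm]]]]] := eventual_poly no_best mj0.
  have lt_mh : (size m < size h)%N by rewrite ltn_modp.
  exists cm => c /evm[_]; rewrite (eqP (_ : count _ _ == 0%N)) //.
  rewrite eqn0Ngt -has_count; apply/hasPn => t t_rsm; apply/negP => nt.
  have := IHn m t (leq_trans lt_mh lt_hn) m0 (ltn_trans lt_mh lt_hq) nt.
  by rewrite mE rootZ ?root_prod_XsubC ?t_rsm ?lead_coef_eq0.
have [c1 [cq1 ch1]] := closer_max w j u cq ch.
have [c2 [cs2 cm2]] := closer_max w j u cs cm.
have [c3 [c13 c23]] := closer_max w j u c1 c2.
have cnt : 1%N = (count (near w j u) rss + count (near w j u) rsh)%N.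
  apply: (eventual_order_uniq no_best (c1 := c3) (A := Aq) (B := As * Ah)) => //.
    exact: mulf_neq0.
  move=> c c3c.
  have [wq _] := evq c (le_trans cq1 (le_trans c13 c3c)).
  have [wh lth] := evh c (le_trans ch1 (le_trans c13 c3c)).
  have [hc0 _] := hevE c (le_trans ch1 (le_trans c13 c3c)).
  have [ws _] := evs c (le_trans cs2 (le_trans c23 c3c)).
  have [sc0 les] := sevE c (le_trans cs2 (le_trans c23 c3c)).
  have wm := evm c (le_trans cm2 (le_trans c23 c3c)).
  rewrite -wq exprD mulrACA.
  rewrite -(eqr_valM ws wh) qsm hornerD hornerM; apply: valD_lt; rewrite wm.
  have -> : m^j.[u] = - (s^j.[u] * h^j.[u]).
    apply/eqP; rewrite -addr_eq0 addrC -hornerM -hornerD -qsm.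
    by rewrite isolated_root_eq0.
  rewrite valN ![s^j.[_] * _]mulrC; apply: ltr_leM => //.
  by case: (count _ rsh) cnt_h lth.
have cnt1 : count (near w j u) rsh = 1%N.
  by case: (count _ rsh) cnt_h cnt => [|[|n']] //; rewrite !addnS.
have [v nv iso_v] := isolated_of_count h0 no_best hE cnt1.
have [c vc] := minq lt_hq iso_v.
by move: nv; rewrite vc (negPf (near_notin _ _ _ _)).
Qed.

(** With z = g(u), the polynomial g - z has u as a near root, hence w (z - g(c))
= w (A (u - c)^N) with N > 0, and the condition for u, raised to the power N,
carries over to the approximations g(c) with d replaced by A d^N. No other b in
F does better: g - b has no near root, so w (g(c) - b) is eventually w (z - b).
*)
Lemma isolated_adjoin_newton g : newton_approx w j g^j.[u].
Proof.
wlog lt_gq : g / (size g < size q)%N => [IH|].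
  have -> : g^j.[u] = (g %% q)^j.[u]; last first.
    by apply: IH; rewrite ltn_modp isolated_neq0.
  rewrite {1}(divp_eq g q) rmorphD rmorphM hornerD hornerM.
  by rewrite isolated_root_eq0 mulr0 add0r.
have [le_g1|lt1g] := leqP (size g) 1.
  by rewrite (size1_polyC le_g1) map_polyC hornerC; apply: newton_approx_base.
set z := g^j.[u].
have g0 (x : E) : g^j - x%:P != 0.
  rewrite subr_eq0; apply: contraTneq lt1g => gE.
  by rewrite -(size_map_poly j) gE -leqNgt size_polyC_leq1.
have [rs [PE [c1 [A [A0 evP]]]]] := eventual_poly no_best (g0 z).
have cnt : (0 < count (near w j u) rs)%N.
  rewrite -has_count; apply/hasP; exists u; last exact: near_self.
  have : root (g^j - z%:P) u by rewrite rootE hornerD hornerN hornerC subrr.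
  by rewrite PE rootZ ?root_prod_XsubC // lead_coef_eq0.
set N := count _ _ in evP cnt.
have {evP PE} wz c : closer w j u c1 c ->
    w (z - j g.[c]) = w (A * (u - j c) ^+ N).
  by move=> /evP[<- _]; rewrite hornerD hornerN hornerC horner_map valBC.
(* Every approximation of z by some b is surpassed by g(c) for c close to u. *)
have cof b : exists c2, forall c, closer w j u c2 c ->
    w (z - j b) <= w (z - j g.[c]).
  have h0 : g - b%:P != 0.
    by rewrite -(map_poly_eq0 j) rmorphB /= map_polyC.
  have lt_h : (size (g - b%:P)%R < size q)%N.
    apply: leq_ltn_trans (size_polyD _ _) _.
    rewrite size_polyN gtn_max lt_gq (leq_ltn_trans (size_polyC_leq1 _)) //.
    exact: ltn_trans lt_gq.
  have hj0 : (g - b%:P)^j != 0 by rewrite map_poly_eq0.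
  have [rsh [hE [c2 [B [B0 evh]]]]] := eventual_poly no_best hj0.
  exists c2 => c /evh[_]; rewrite (eqP (_ : count _ _ == 0%N)); last first.
    rewrite eqn0Ngt -has_count; apply/hasPn => t t_rsh; apply/negP => nt.
    have := isolated_no_near h0 lt_h nt.
    by rewrite hE rootZ ?root_prod_XsubC ?t_rsh ?lead_coef_eq0.
  rewrite rmorphB /= map_polyC !hornerD !hornerN !hornerC horner_map -/z => eqw.
  rewrite (_ : z - j g.[c] = (z - j b) - (j g.[c] - j b)); last by ring.
  by apply: valB_ge => //; rewrite eqw.
have [d [[c0 dc0] step]] := newton_u.
have d0 := val_lt_neq0 dc0.
exists (A * d ^+ N); split=> [|b _].
  have [c [cc1 cc0]] := closer_max w j u c1 c0.
  exists g.[c]; rewrite wz // ltr_val2l // ltr_valX //.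
  exact: lt_le_trans cc0.
have [c2 c2b] := cof b.
have [c3 [c13 c03]] := closer_max w j u c1 c0.
have [c [c3c c2c]] := closer_max w j u c3 c2.
have dc : w d < w (u - j c) by apply: lt_le_trans dc0 (le_trans c03 c3c).
have [c' le_c'] := step c dc.
have cc' : closer w j u c c'.
  rewrite /closer -(ler_val2l _ _ _ d0); apply: le_trans le_c'.
  by rewrite expr2; apply: ler_valM => //; apply: ltW.
exists g.[c']; apply: le_trans (ler_valX 2 (c2b c c2c)) _.
have wzc := wz c (le_trans c13 c3c).
rewrite expr2 (eqr_valM wzc wzc).
apply: (@le_trans _ _ (w (A * d ^+ N * (A * (u - j c') ^+ N)))); last first.
  have wzc' := wz c' (le_trans c13 (le_trans c3c cc')).
  by rewrite (eqr_valM (erefl (w (A * d ^+ N))) wzc').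
rewrite mulrACA [A * d ^+ N * _]mulrACA -!exprMn -expr2.
by apply/val_mul2l_le/ler_valX.
Qed.

End MinimalDegree.
End Isolated.

(** * Subrings which are fields, and automorphisms *)

(** The union of the empty chain need not satisfy P; starting from X0 avoids
this. *)
Lemma Zorn_above (T : Type) (P : set (set T)) (X0 : set T) : P X0 ->
    (forall C, (C `<=` P)%classic -> (C !=set0)%classic -> total_on C subset ->
       P (\bigcup_(X in C) X)%classic) ->
  exists A, [/\ P A, (X0 `<=` A)%classic &
    forall B, P B -> (A `<=` B)%classic -> (B `<=` A)%classic].
Proof.
move=> PX0 chainP; pose Q X := P (X0 `|` X)%classic.
have [|A [QA maxA]] := @Zorn_bigcup T Q.
  move=> C CQ totC.
  have [C0|/nonemptyPn nC] := pselect (C !=set0)%classic; last first.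
    by rewrite /Q nC bigcup_set0 setU0.
  rewrite /Q (_ : setU _ _ =
    \bigcup_(X in [set (X0 `|` X)%classic | X in C]) X)%classic.
    apply: chainP; first by move=> _ [X CX <-]; apply: CQ.
      by have [X CX] := C0; exists (X0 `|` X)%classic, X.
    move=> _ _ [X CX <-] [Y CY <-].
    by have [XY|YX] := totC X Y CX CY; [left|right]; apply: setUS.
  rewrite bigcup_image; apply/seteqP.
  split=> [x [X0x|[X CX Xx]]|x [X CX [X0x|Xx]]].
  - by have [X CX] := C0; exists X => //; left.
  - by exists X => //; right.
  - by left.
  - by right; exists X.
exists (X0 `|` A)%classic; split=> [|x X0x|B PB]; [exact: QA|by left|].
rewrite subUset => -[X0B AB] x Bx; right; apply: contrapT => nAx.
have ltAB : (A `<` B)%classic by split=> // /(_ x Bx).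
by case: (maxA B ltAB); rewrite /Q (setUidPr _ _).2.
Qed.

(** It serves both for subrings of a field and for graphs of partial
isomorphisms, which are subrings of a product of two fields. *)
Record inv_subring (R : comNzRingType) := InvSubring {
  isr_set :> R -> Prop;
  isr1 : isr_set 1;
  isrB : forall x y, isr_set x -> isr_set y -> isr_set (x - y);
  isrM : forall x y, isr_set x -> isr_set y -> isr_set (x * y);
  isrV : forall x, isr_set x -> x != 0 -> exists2 y, isr_set y & y * x = 1
}.

Section SubringField.
Variables (R : comNzRingType) (S : inv_subring R).

Definition isr_pred : {pred R} := fun x => `[<S x>].

Fact isr_closed : subring_closed isr_pred.
Proof.
by split=> [|x y /asboolP Sx /asboolP Sy|x y /asboolP Sx /asboolP Sy];
  apply/asboolP; [apply: isr1|apply: isrB|apply: isrM].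
Qed.

HB.instance Definition _ := GRing.isSubringClosed.Build R isr_pred isr_closed.

Record isr_field := IsrField { isr_val : R; _ : isr_pred isr_val }.

HB.instance Definition _ := [isSub for isr_val].
HB.instance Definition _ := [Choice of isr_field by <:].
HB.instance Definition _ := [SubChoice_isSubComNzRing of isr_field by <:].

Lemma isr_fieldP (x : isr_field) : S (val x).
Proof. by apply/asboolP/(valP x). Qed.

Fact isr_unit (x : isr_field) : x != 0 -> exists y, y * x = 1.
Proof.
move=> x0; have [|y Sy yx] := isrV (isr_fieldP x).
  by rewrite -(rmorph0 (val : isr_field -> R)) (inj_eq val_inj).
by exists (IsrField (asboolT Sy)); apply: val_inj; rewrite rmorphM rmorph1.
Qed.

Definition isr_inv (x : isr_field) : isr_field :=
  if pselect (exists y, y * x = 1) is left h then projT1 (cid h) else 0.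

Fact isr_mulVf x : x != 0 -> isr_inv x * x = 1.
Proof.
rewrite /isr_inv; case: pselect => [h _|h /isr_unit//].
exact: projT2 (cid h).
Qed.

Fact isr_inv0 : isr_inv 0 = 0.
Proof.
rewrite /isr_inv; case: pselect => // h; exfalso; case: h => y /eqP.
by rewrite mulr0 eq_sym oner_eq0.
Qed.

HB.instance Definition _ :=
  GRing.ComNzRing_isField.Build isr_field isr_mulVf isr_inv0.

End SubringField.

Lemma irreducible_root_dvd (A E : fieldType) (i : {rmorphism A -> E})
    (p g : {poly A}) (x : E) : irreducible_poly p -> root (map_poly i p) x ->
  root (map_poly i g) x = (p %| g).
Proof.
move=> irr_p px; apply/idP/idP => [gx|pg]; last first.
  by move/dvdpP: pg => [r ->]; rewrite rmorphM rootM px orbT.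
have p0 := irredp_neq0 irr_p.
have dx : root (map_poly i (gcdp p g)) x by rewrite gcdp_map root_gcd px gx.
have d0 : gcdp p g != 0 by rewrite gcdp_eq0 negb_and p0.
have /eqp_dvdl <- : gcdp p g %= p.
  apply: irr_p.2; last exact: dvdp_gcdl.
  by rewrite -(size_map_poly i) gtn_eqF // (root_size_gt1 _ dx) ?map_poly_eq0.
exact: dvdp_gcdr.
Qed.

(** Remove from an equation of x its factors X; the constant term becomes
invertible. *)
Lemma algebraic_inv (F E : fieldType) (j : {rmorphism F -> E}) (x : E) :
  algebraicOver j x -> x != 0 -> exists q, (map_poly j q).[x] * x = 1.
Proof.
move=> [p p0 px] x0.
have [m [q /implyP/(_ p0) q0 pE]] := multiplicity_XsubC p 0.
have qx : root (map_poly j q) x.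
  move: px; rewrite pE subr0 rmorphM /= map_polyXn rootM => /orP[//|].
  by rewrite rootE hornerXn expf_eq0 (negPf x0) andbF.
have /factor_theorem[r rE] : root (q - q.[0]%:P) 0.
  by rewrite rootE hornerD hornerN hornerC subrr.
exists (- q.[0]^-1 *: r); rewrite map_polyZ hornerZ -mulrA.
have -> : (map_poly j r).[x] * x = - j q.[0].
  have qE : q = r * 'X + q.[0]%:P.
    by rewrite -{1}(subrK q.[0]%:P q) rE subr0.
  apply/eqP; rewrite -addr_eq0; move: qx; rewrite {1}qE rootE rmorphD rmorphM /=.
  by rewrite map_polyX map_polyC hornerD hornerM hornerX hornerC.
by rewrite rmorphN mulrNN -rmorphM mulVf ?rmorph1 // -rootE.
Qed.

Lemma poly_lift (F E : fieldType) (j : {rmorphism F -> E}) (P : {poly E}) :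
  (forall k, exists c, P`_k = j c) -> exists q, map_poly j q = P.
Proof.
move=> /choice[c cE]; exists (\poly_(k < size P) c k); apply/polyP => k.
rewrite coef_map coef_poly; case: ltnP => [_|le_k]; first by rewrite cE.
by rewrite nth_default //; apply: rmorph0.
Qed.

Section Automorphisms.
Variables (F : fieldType) (E : closedFieldType) (j : {rmorphism F -> E}).
Hypothesis alg : forall x : E, algebraicOver j x.

(** Such a set X is the graph of an isomorphism over F between two subrings of
E: as X is closed under subtraction, the last condition says that X is
single-valued and injective. *)
Record partial_iso (X : set (E * E)) : Prop := PartialIso {
  piso_base : forall c, X (j c, j c);
  pisoB : forall s t, X s -> X t -> X (s - t);
  pisoM : forall s t, X s -> X t -> X (s * t);
  piso0 : forall s, X s -> (s.1 == 0) = (s.2 == 0)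
}.

Lemma piso_horner X (q : {poly F}) s : partial_iso X -> X s ->
  X ((map_poly j q).[s.1], (map_poly j q).[s.2]).
Proof.
move=> pX Xs; elim/poly_ind: q => [|q c IHq].
  by rewrite rmorph0 !horner0 -(rmorph0 j); apply: piso_base.
rewrite rmorphD rmorphM /= map_polyX map_polyC !hornerMXaddC.
have -> : ((map_poly j q).[s.1] * s.1 + j c, (map_poly j q).[s.2] * s.2 + j c) =
    ((map_poly j q).[s.1], (map_poly j q).[s.2]) * s - (j (- c), j (- c)).
  by rewrite rmorphN; case: s {Xs IHq} => a b; congr pair; rewrite /= opprK.
by apply: pisoB => //; [apply: pisoM|apply: piso_base].
Qed.

Lemma piso_inv X s : partial_iso X -> X s -> s != 0 ->
  exists2 t, X t & t * s = 1.
Proof.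
move=> pX Xs s0; have s10 : s.1 != 0.
  apply: contra s0 => s10; move: (s10); rewrite (piso0 pX Xs) => s20.
  by apply/eqP; case: s s10 s20 {Xs} => a b /= /eqP -> /eqP ->.
have [q q1] := algebraic_inv (alg s.1) s10.
have Xt := piso_horner q pX Xs.
exists ((map_poly j q).[s.1], (map_poly j q).[s.2]) => //.
have X1 : X (1, 1) by have := piso_base pX 1; rewrite rmorph1.
have := piso0 pX (pisoB pX (pisoM pX Xt Xs) X1).
rewrite /= q1 subrr eqxx => /esym; rewrite subr_eq0 => /eqP q2.
by case: s q1 q2 {Xs s0 s10 Xt} => a b /= q1 q2; congr pair.
Qed.

Definition graph_adjoin (A : fieldType) (i1 i2 : {rmorphism A -> E}) x y :=
  [set s | exists g : {poly A},
    s = ((map_poly i1 g).[x], (map_poly i2 g).[y])]%classic.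

Lemma piso_adjoin (A : fieldType) (i1 i2 : {rmorphism A -> E})
    (p : {poly A}) x y :
    (forall c, exists a, i1 a = j c /\ i2 a = j c) ->
    irreducible_poly p -> root (map_poly i1 p) x -> root (map_poly i2 p) y ->
  partial_iso (graph_adjoin i1 i2 x y).
Proof.
move=> base irr_p px py; split.
- move=> c; have [a [a1 a2]] := base c; exists a%:P.
  by rewrite !map_polyC !hornerC /= a1 a2.
- by move=> _ _ [g ->] [h ->]; exists (g - h); rewrite !rmorphB !hornerD !hornerN.
- by move=> _ _ [g ->] [h ->]; exists (g * h); rewrite !rmorphM !hornerM.
- move=> _ [g ->] /=; rewrite -!rootE.
  by rewrite (irreducible_root_dvd g irr_p px) (irreducible_root_dvd g irr_p py).
Qed.

(** The graph is itself a field A, with two embeddings into E. The irreducible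
equation of x over A has a root under the second embedding too, and evaluation
at the two roots has the same kernel. *)
Lemma piso_extend X x : partial_iso X -> exists Y y,
  [/\ partial_iso Y, (X `<=` Y)%classic & Y (x, y)].
Proof.
move=> pX; have X1 : X 1 by have := piso_base pX 1; rewrite rmorph1.
pose S := InvSubring X1 (pisoB pX) (pisoM pX) (fun s => @piso_inv X s pX).
pose i1 : {rmorphism isr_field S -> E} := fst \o val.
pose i2 : {rmorphism isr_field S -> E} := snd \o val.
pose b c : isr_field S := IsrField (asboolT (piso_base pX c : S _)).
have base c : exists a, i1 a = j c /\ i2 a = j c by exists (b c).
have [p0 p00 p0x] := alg x.
have [f fE] : exists f : {poly isr_field S}, map_poly i1 f = map_poly j p0.
  by apply: poly_lift => k; rewrite coef_map; exists (b p0`_k).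
have f0 : f != 0 by rewrite -(map_poly_eq0 i1) fE map_poly_eq0.
have fx : root (map_poly i1 f) x by rewrite fE.
have [p [irr_p px _]] := irreducible_root_factor f0 fx.
have [y py] : exists y, root (map_poly i2 p) y.
  by apply/closed_rootP; rewrite size_map_poly neq_ltn irr_p.1 orbT.
exists (graph_adjoin i1 i2 x y), y; split.
- exact: piso_adjoin irr_p px py.
- move=> s Xs; exists (IsrField (asboolT (Xs : S _)))%:P.
  by rewrite !map_polyC !hornerC /=; case: s Xs.
- by exists 'X; rewrite !map_polyX !hornerX.
Qed.

Lemma piso_swap X : partial_iso X -> partial_iso [set s | X (s.2, s.1)]%classic.
Proof.
move=> pX; split=> [c|s t|s t|s /(piso0 pX)] /=; first exact: piso_base.
- exact: pisoB.
- exact: pisoM.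
- by [].
Qed.

(** Extending a maximal graph in either coordinate shows that it is the graph of
an automorphism. *)
Lemma piso_maximal X0 : partial_iso X0 -> exists X,
  [/\ partial_iso X, (X0 `<=` X)%classic, forall x, exists y, X (x, y) &
      forall y, exists x, X (x, y)].
Proof.
move=> pX0; have [|X [pX X0X maxX]] := Zorn_above pX0.
  move=> C CP [X CX] totC.
  have common s t : (\bigcup_(X in C) X)%classic s ->
      (\bigcup_(X in C) X)%classic t -> exists Y, [/\ C Y, Y s & Y t].
    move=> [Y CY Ys] [Z CZ Zt]; have [YZ|ZY] := totC Y Z CY CZ.
      by exists Z; split=> //; apply: YZ.
    by exists Y; split=> //; apply: ZY.
  split=> [c|s t Cs Ct|s t Cs Ct|s [Y CY Ys]].
  - by exists X => //; apply: piso_base (CP X CX) c.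
  - have [Y [CY Ys Yt]] := common s t Cs Ct.
    by exists Y => //; apply: pisoB (CP Y CY) _ _ Ys Yt.
  - have [Y [CY Ys Yt]] := common s t Cs Ct.
    by exists Y => //; apply: pisoM (CP Y CY) _ _ Ys Yt.
  - exact: piso0 (CP Y CY) _ Ys.
exists X; split=> // z.
  by have [Y [y [pY XY Yzy]]] := piso_extend z pX; exists y; apply: (maxX Y).
have [Y [x [pY XY Yzx]]] := piso_extend z (piso_swap pX); exists x.
by apply: (maxX _ (piso_swap pY)) => // s Xs; apply: XY; case: s Xs.
Qed.

Definition base_automorphism (s : {rmorphism E -> E}) :=
  bijective s /\ forall c, s (j c) = j c.

Lemma root_automorphism (p : {poly F}) x y : irreducible_poly p ->
  root (map_poly j p) x -> root (map_poly j p) y ->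
  exists2 s : {rmorphism E -> E}, base_automorphism s & s x = y.
Proof.
move=> irr_p px py; have base c : exists a, j a = j c /\ j a = j c by exists c.
have [X [pX X0X totl totr]] := piso_maximal (piso_adjoin base irr_p px py).
have uniql a b c : X (a, b) -> X (a, c) -> b = c.
  move=> Xab Xac; apply/eqP; rewrite -subr_eq0.
  by have := piso0 pX (pisoB pX Xab Xac); rewrite /= subrr eqxx => <-.
have uniqr a b c : X (a, c) -> X (b, c) -> a = b.
  move=> Xac Xbc; apply/eqP; rewrite -subr_eq0.
  by have := piso0 pX (pisoB pX Xac Xbc); rewrite /= subrr eqxx => ->.
pose s a := projT1 (cid (totl a)); pose t b := projT1 (cid (totr b)).
have sP a : X (a, s a) by apply: projT2 (cid (totl a)).
have tP b : X (t b, b) by apply: projT2 (cid (totr b)).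
have X1 : X (1, 1) by have := piso_base pX 1; rewrite rmorph1.
have sB : zmod_morphism s.
  by move=> a b; apply: uniql (sP _) (pisoB pX (sP a) (sP b)).
have sM : monoid_morphism s.
  split=> [|a b]; first exact: uniql (sP _) X1.
  by apply: uniql (sP _) (pisoM pX (sP a) (sP b)).
pose mB := GRing.isZmodMorphism.Build E E s sB.
pose mM := GRing.isMonoidMorphism.Build E E s sM.
pose sm : {rmorphism E -> E} := HB.pack s mB mM.
exists sm; first split.
- exists t => a; first by apply: uniqr (tP _) (sP a).
  by apply: uniql (sP _) (tP a).
- by move=> c; apply: uniql (sP _) (piso_base pX c).
- by apply: uniql (sP x) (X0X _ _); exists 'X; rewrite !map_polyX !hornerX.
Qed.

(** A root of a separable irreducible polynomial of degree at least 2 can be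
moved to another root. *)
Lemma separable_fixed x : separable_over j x ->
  (forall s, base_automorphism s -> s x = x) -> exists c, x = j c.
Proof.
move=> [p [irr_p px sep_p]] fix_x.
have [r pE] := factor_theorem _ _ px.
have p0 : map_poly j p != 0 by rewrite map_poly_eq0 irredp_neq0.
have r0 : r != 0 by apply: contraNneq p0 => r0; rewrite pE r0 mul0r.
have [r1|/closed_rootP[y ry]] := eqVneq (size r) 1.
  have size_p : size p = 2.
    by rewrite -(size_map_poly j) pE size_Mmonic ?monicXsubC // size_XsubC r1.
  have [c pc] := poly2_root size_p; exists c.
  have /eqp_dvdr eq_p : 'X - c%:P %= p.
    by rewrite -dvdp_size_eqp ?dvdp_XsubCl // size_XsubC size_p.
  have := irreducible_root_dvd ('X - c%:P) irr_p px.
  by rewrite eq_p dvdpp map_polyXsubC root_XsubC => /eqP.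
have ry' : root (map_poly j p) y by rewrite pE rootM ry.
have [s /fix_x sx xy] := root_automorphism irr_p px ry'.
have := sep_p; rewrite -(separable_map j) pE separable_root => /andP[_ /negP[]].
by rewrite -sx xy.
Qed.

End Automorphisms.

(** * Conjugate elements over a henselian field *)

Section BigValuations.
Variables (E : fieldType) (G : orderedAbGroupType) (w : valuation E G).
Variables (T : finType) (f : T -> E).

Lemma val_sum_gt (A : {set T}) x : x != 0 ->
  (forall i, i \in A -> w x < w (f i)) -> w x < w (\sum_(i in A) f i).
Proof.
move=> x0 ltf; elim/big_ind: _ => [|a b xa xb|i /ltf//]; first exact: val_lt0.
by rewrite -[b]opprK; apply: valB_gt; rewrite ?valN.
Qed.

Lemma val_prod_le (A : {set T}) x : (forall i, i \in A -> w (f i) <= w x) ->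
  w (\prod_(i in A) f i) <= w (x ^+ #|A|).
Proof.
move=> lef; rewrite -prodr_const.
by elim/big_rec2: _ => // i a b Ai ab; apply: ler_valM => //; apply: lef.
Qed.

Lemma val_prod_ge (A : {set T}) x : (forall i, i \in A -> w x <= w (f i)) ->
  w (x ^+ #|A|) <= w (\prod_(i in A) f i).
Proof.
move=> lef; rewrite -prodr_const.
by elim/big_rec2: _ => // i a b Ai ab; apply: ler_valM => //; apply: lef.
Qed.

Lemma val_prod_gt (A : {set T}) x : x != 0 -> A != finset.set0 ->
    (forall i, i \in A -> w x < w (f i)) ->
  w (x ^+ #|A|) < w (\prod_(i in A) f i).
Proof.
move=> x0 /set0Pn[i Ai] ltf; rewrite (cardsD1 i) Ai.
rewrite (finset.big_setD1 i) //= exprS.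
apply: ltr_leM; rewrite ?expf_neq0 ?ltf //.
by apply: val_prod_ge => k; rewrite inE => /andP[_ /ltf/ltW].
Qed.

(** Passing from I to J replaces elements of value at most w x by equally many
elements of larger value. *)
Lemma val_prod_lt_exchange (I J : {set T}) x : x != 0 ->
    (forall i, (i \in I) = (w (f i) <= w x)) -> #|J| = #|I| -> J != I ->
  w (\prod_(i in I) f i) < w (\prod_(i in J) f i).
Proof.
move=> x0 IP cardJ neqJ.
have f0 i : i \in I -> f i != 0.
  rewrite IP => le_ix; apply: contraTneq le_ix => ->.
  by rewrite -ltNge val_lt0.
have cardD : #|J :\: I| = #|I :\: J| by rewrite !cardsD cardJ finset.setIC.
rewrite (big_setID J) [X in _ < w X](big_setID I) /= finset.setIC.
rewrite ltr_val2l; last first.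
  by apply/prodf_neq0 => i; rewrite inE => /andP[_ /f0].
apply: (@le_lt_trans _ _ (w (x ^+ #|J :\: I|))).
  by rewrite cardD; apply: val_prod_le => i; rewrite inE IP => /andP[].
apply: val_prod_gt => // [|i]; last by rewrite inE IP -ltNge => /andP[].
rewrite finset.setD_eq0; apply: contra neqJ => subJ.
by rewrite eqEcard subJ cardJ leqnn.
Qed.

End BigValuations.

Lemma separable_over_automorphism (K E : fieldType) (i : {rmorphism K -> E})
    (s : {rmorphism E -> E}) x : (forall c, s (i c) = i c) ->
  separable_over i x -> separable_over i (s x).
Proof.
move=> si [p [irr_p px sep_p]]; exists p; split=> //.
by move: px; rewrite -(fmorph_root s) -map_poly_comp (eq_map_poly (g := i)).
Qed.

Section Henselian.
Variables (E : closedFieldType) (G : orderedAbGroupType) (w : valuation E G).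
Variables (F : fieldType) (j : {rmorphism F -> E}).
Hypothesis alg : forall x : E, algebraicOver j x.

(** Hensel's lemma, in the form of rationality of isolated roots. *)
Definition henselian := forall q u, isolated_root w j q u -> exists c, u = j c.

Hypothesis hensF : henselian.

(** The products of #|I0| conjugates are the roots of a polynomial Q over F.
Their sum t lies in F and is dominated by the product over I0, so that t is the
center of a ball which contains no other root of Q. Thus the product over I0
lies in F, but s maps it to the product over another set of roots. *)
Lemma henselian_val_le s x : base_automorphism j s -> separable_over j x ->
  w (s x) <= w x.
Proof.
move=> js [p [irr_p px sep_p]]; rewrite leNgt; apply/negP => lt_sx.
have p0 : map_poly j p != 0 by rewrite map_poly_eq0 irredp_neq0.
have [rs pE] := closed_field_poly_normal (map_poly j p).
have rsP r : (r \in rs) = root (map_poly j p) r.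
  by rewrite pE rootZ ?lead_coef_eq0 // root_prod_XsubC.
pose T := seq_sub rs.
pose xT : T := SeqSub (etrans (rsP x) px).
pose prodJ (J : {set T}) : E := \prod_(r in J) val r.
pose I0 := [set r : T | w (val r) <= w x].
pose Fam := [set J : {set T} | #|J| == #|I0|].
pose t := \sum_(J in Fam) prodJ J.
pose Q := \prod_(J in Fam) ('X - (prodJ J)%:P).
have rootT (a : {rmorphism E -> E}) (r : T) :
    base_automorphism j a -> a (val r) \in rs.
  move=> [_ aj]; have := valP r; rewrite /= !rsP => rr.
  rewrite -(fmorph_root a) -map_poly_comp in rr.
  by rewrite (eq_map_poly (g := j)) in rr.
pose act a ja : T -> T := fun r => SeqSub (rootT a r ja).
have act_inj a ja : injective (act a ja).
  by move=> r r' /(congr1 val) /= /fmorph_inj/val_inj.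
have actX (a : {rmorphism E -> E}) (ja : base_automorphism j a) J :
    a (prodJ J) = prodJ (act a ja @: J).
  by rewrite rmorph_prod /prodJ big_imset //; apply: in2W; apply: act_inj.
have actFam a ja (J : {set T}) : (act a ja @: J \in Fam) = (J \in Fam).
  by rewrite !inE card_imset.
have fixed_t (a : {rmorphism E -> E}) : base_automorphism j a -> a t = t.
  move=> ja; rewrite rmorph_sum /t.
  rewrite [RHS](reindex_inj (imset_inj (@act_inj a ja))).
  by apply: eq_big => [J|J _]; rewrite ?actFam ?actX.
have fixed_Q (a : {rmorphism E -> E}) : base_automorphism j a -> map_poly a Q = Q.
  move=> ja; rewrite rmorph_prod /Q.
  rewrite [RHS](reindex_inj (imset_inj (@act_inj a ja))).
  apply: eq_big => [J|J _]; first by rewrite actFam.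
  by rewrite /= map_polyXsubC (actX a ja).
have sepX J : prodJ J \in sep_pred j.
  apply: rpred_prod => r _; apply/asboolP; exists p; split=> //.
  by rewrite -rsP; apply: valP.
have [t' tE] : exists c, t = j c.
  apply: (separable_fixed alg) fixed_t.
  have /asboolP// : t \in sep_pred j by apply: rpred_sum.
have [q qE] : exists q, map_poly j q = Q.
  apply: poly_lift => k; apply: (separable_fixed alg) => [|a ja]; last first.
    by rewrite -{2}(fixed_Q a ja) coef_map.
  have /polyOverP/(_ k)/asboolP// : Q \is a polyOver (sep_pred j).
  by apply: rpred_prod => J _; rewrite polyOverXsubC sepX.
have x0 : x != 0 := val_lt_neq0 lt_sx.
have I0P (r : T) : (r \in I0) = (w (val r) <= w x) by rewrite inE.
have ltX J : J \in Fam -> J != I0 -> w (prodJ I0) < w (prodJ J).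
  by rewrite inE => /eqP cardJ; apply: val_prod_lt_exchange I0P cardJ.
have I0Fam : I0 \in Fam by rewrite inE.
have X0 : prodJ I0 != 0.
  apply/prodf_neq0 => r; rewrite I0P => le_r; apply: contraTneq le_r => ->.
  by rewrite -ltNge val_lt0.
have lt_t : w (prodJ I0) < w (t - prodJ I0).
  rewrite /t (finset.big_setD1 I0) //= addrAC subrr add0r.
  by apply: val_sum_gt => // J; rewrite in_setD1 => /andP[neqJ JFam]; apply: ltX.
have [c cE] : exists c, prodJ I0 = j c.
  apply: (hensF (q := q)).
  exists 1, [seq prodJ J | J <- enum (Fam :\ I0)], t', (prodJ I0); split.
  - exact: oner_neq0.
  - by rewrite qE scale1r /Q (finset.big_setD1 I0) //= big_cons big_map big_enum.
  - by rewrite -tE valBC.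
  - move=> r /mapP[J]; rewrite mem_enum in_setD1 => /andP[neqJ JFam] ->.
    have -> : prodJ J - j t' = - prodJ I0 + (prodJ J - (t - prodJ I0)).
      by rewrite -tE; ring.
    by rewrite valD_lt valN //; apply: valB_gt => //; apply: (ltX J).
have : act s js @: I0 != I0.
  apply/eqP => /setP/(_ (act s js xT)); rewrite mem_imset; last exact: act_inj.
  by rewrite !inE /= lexx leNgt lt_sx.
by move/ltX; rewrite actFam -actX cE js.2 ltxx => /(_ I0Fam).
Qed.

Lemma henselian_val s x : base_automorphism j s -> separable_over j x ->
  w (s x) = w x.
Proof.
move=> js sx; apply/le_anti; rewrite henselian_val_le //=.
have [[s' sK s'K] sj] := js.
have s'B : zmod_morphism s'.
  by move=> a b; apply: (can_inj sK); rewrite rmorphB /= !s'K.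
have s'M : monoid_morphism s'.
  by split=> [|a b]; apply: (can_inj sK); rewrite ?rmorph1 ?rmorphM /= !s'K.
pose mB := GRing.isZmodMorphism.Build E E s' s'B.
pose mM := GRing.isMonoidMorphism.Build E E s' s'M.
pose sm : {rmorphism E -> E} := HB.pack s' mB mM.
have jsm : base_automorphism j sm.
  by split=> [|c]; [exists s|apply: (can_inj sK); rewrite /= s'K sj].
rewrite -{1}(sK x); apply: (henselian_val_le jsm).
exact: separable_over_automorphism.
Qed.

End Henselian.

(** * A maximal ring of quadratically approximable elements *)

Section MaximalNewtonRing.
Variables (K : fieldType) (E : closedFieldType) (i : {rmorphism K -> E}).
Variables (G : orderedAbGroupType) (w : valuation E G).
Hypothesis alg : forall x : E, algebraicOver i x.

Record newton_ring (X : set E) : Prop := NewtonRing {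
  nring_base : forall c, X (i c);
  nringB : forall x y, X x -> X y -> X (x - y);
  nringM : forall x y, X x -> X y -> X (x * y);
  nring_newton : forall x, X x -> newton_approx w i x
}.

Lemma nring_inv X x : newton_ring X -> X x -> x != 0 ->
  exists2 y, X y & y * x = 1.
Proof.
move=> nX Xx x0; have [q qx] := algebraic_inv (alg x) x0.
exists (map_poly i q).[x] => //; elim/poly_ind: q {qx} => [|q c IHq].
  by rewrite rmorph0 horner0 -(rmorph0 i); apply: nring_base.
rewrite rmorphD rmorphM /= map_polyX map_polyC hornerMXaddC.
have -> : (map_poly i q).[x] * x + i c = (map_poly i q).[x] * x - i (- c).
  by rewrite rmorphN opprK.
by apply: (nringB nX); [apply: nringM|apply: nring_base].
Qed.

Lemma maximal_newton_ring : exists X, newton_ring X /\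
  forall Y, newton_ring Y -> (X `<=` Y)%classic -> (Y `<=` X)%classic.
Proof.
have [| |X [nX _ maxX]] := @Zorn_above E newton_ring (range i); last by exists X.
- split=> [c|_ _ [a _ <-] [b _ <-]|_ _ [a _ <-] [b _ <-]|_ [a _ <-]].
  + by exists c.
  + by exists (a - b); rewrite ?rmorphB.
  + by exists (a * b); rewrite ?rmorphM.
  + exact: newton_approx_base.
move=> C CP [X CX] totC.
have common x y : (\bigcup_(X in C) X)%classic x ->
    (\bigcup_(X in C) X)%classic y -> exists Y, [/\ C Y, Y x & Y y].
  move=> [Y CY Yx] [Z CZ Zy]; have [YZ|ZY] := totC Y Z CY CZ.
    by exists Z; split=> //; apply: YZ.
  by exists Y; split=> //; apply: ZY.
split=> [c|x y Cx Cy|x y Cx Cy|x [Y CY Yx]].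
- by exists X => //; apply: nring_base (CP X CX) c.
- have [Y [CY Yx Yy]] := common x y Cx Cy.
  by exists Y => //; apply: nringB (CP Y CY) _ _ Yx Yy.
- have [Y [CY Yx Yy]] := common x y Cx Cy.
  by exists Y => //; apply: nringM (CP Y CY) _ _ Yx Yy.
- exact: nring_newton (CP Y CY) _ Yx.
Qed.

(** An isolated root outside of F, chosen with a polynomial of least degree,
generates a larger ring of quadratically approximable elements. *)
Lemma maximal_newton_field : exists (F : fieldType) (j : {rmorphism F -> E}),
  [/\ forall k, exists c, i k = j c, forall c, newton_approx w i (j c) &
      henselian w j].
Proof.
have [X [nX maxX]] := maximal_newton_ring.
have X1 : X 1 by have := nring_base nX 1; rewrite rmorph1.
pose S := InvSubring X1 (nringB nX) (nringM nX) (fun x => @nring_inv X x nX).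
pose j : {rmorphism isr_field S -> E} := val.
have base k : exists c, i k = j c.
  by exists (IsrField (asboolT (nring_base nX k : S _))).
have newtonX c : newton_approx w i (j c).
  by apply: (nring_newton nX); apply: (isr_fieldP c).
exists (isr_field S), j; split=> // q0 u0 iso0; apply: contrapT => u0F.
pose bad n := `[<exists q u,
  [/\ isolated_root w j q u, ~ (exists c, u = j c) & size q = n]>].
have : exists n, bad n by exists (size q0); apply/asboolP; exists q0, u0.
case/ex_minnP=> n /asboolP[q [u [iso uF size_q]]] min_n.
pose Y : set E :=
  [set x | exists g : {poly isr_field S}, x = (map_poly j g).[u]]%classic.
have nY : newton_ring Y.
  split=> [k|_ _ [g ->] [h ->]|_ _ [g ->] [h ->]|_ [g ->]].
  - by have [c ->] := base k; exists c%:P; rewrite map_polyC hornerC.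
  - by exists (g - h); rewrite rmorphB hornerD hornerN.
  - by exists (g * h); rewrite rmorphM hornerM.
  - apply: newton_trans base newtonX _; apply: isolated_adjoin_newton iso _ _.
      by move=> c uc; apply: uF; exists c.
    move=> h v lt_hq iso_v; apply: contrapT => vF.
    move: lt_hq; rewrite size_q ltnNge => /negP; apply; apply: min_n.
    by apply/asboolP; exists h, v.
have XY : (X `<=` Y)%classic.
  move=> x Xx; exists (IsrField (asboolT (Xx : S _)))%:P.
  by rewrite map_polyC hornerC.
have Xu : X u.
  by apply: (maxX Y nY XY); exists 'X; rewrite map_polyX hornerX.
by apply: uF; exists (IsrField (asboolT (Xu : S _))).
Qed.

(** An automorphism of E over F preserves the values of separable elements, so
that it restricts to an element of the decomposition group and fixes K^h.
Separable elements with this property belong to F. *)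
Lemma henselization_newton (a : henselization i w) :
  newton_approx w i (hens_incl a).
Proof.
have [F [j [base newtonF hensF]]] := maximal_newton_field.
have lift p : exists f, map_poly j f = map_poly i p.
  by apply: poly_lift => k; rewrite coef_map; apply: base.
have algj x : algebraicOver j x.
  have [p p0 px] := alg x; have [f fE] := lift p; exists f; rewrite ?fE //.
  by rewrite -(map_poly_eq0 j) fE map_poly_eq0.
have sepj x : separable_over i x -> separable_over j x.
  move=> [p [irr_p px sep_p]]; have [f fE] := lift p.
  apply/separable_overP; exists f; rewrite ?fE //.
  by rewrite -(separable_map j) fE separable_map.
suff [c ->] : exists c, hens_incl a = j c by [].
have sep_a : separable_over i (hens_incl a) by apply/asboolP/(valP (val a)).
apply: (separable_fixed algj (sepj _ sep_a)) => s js.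
have si k : s (i k) = i k by have [c ->] := base k; apply: js.2.
have [s' sK s'K] := js.1.
have sepS (x : sep_closure i) : sep_pred i (s (val x)).
  by apply/asboolP/separable_over_automorphism => //; apply/asboolP/(valP x).
have wE x : separable_over i x -> w (s x) = w x.
  by move=> sx; apply: henselian_val js (sepj _ sx).
pose f (x : sep_closure i) := SepClosure (sepS x).
have fB : zmod_morphism f by move=> x y; apply: val_inj; rewrite /= !rmorphB.
have fM : monoid_morphism f.
  by split=> [|x y]; apply: val_inj; rewrite /= ?rmorph1 ?rmorphM.
pose mB := GRing.isZmodMorphism.Build _ _ f fB.
pose mM := GRing.isMonoidMorphism.Build _ _ f fM.
pose fm : {rmorphism sep_closure i -> sep_closure i} := HB.pack f mB mM.
have decf : decomposition w fm.
  split; last by move=> x; apply/wE/asboolP/(valP x).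
  split; last by move=> c; apply: val_inj; apply: si.
  have sepS' (x : sep_closure i) : sep_pred i (s' (val x)).
    have /asboolP[p [irr_p px sep_p]] := valP x.
    apply/asboolP; exists p; split=> //.
    by rewrite -(fmorph_root s) -map_poly_comp (eq_map_poly (g := i)) //= s'K.
  exists (fun x => SepClosure (sepS' x)) => x;
    by apply: val_inj; rewrite /= ?sK ?s'K.
by have /asboolP/(_ fm decf)/(congr1 val) := valP a.
Qed.

End MaximalNewtonRing.

(** * Convex subgroups from quadratic approximation *)

Lemma val_divE (E : fieldType) (G : orderedAbGroupType) (w : valuation E G)
  (x y : E) a b : w x = Fin a -> w y = Fin b -> w (x / y) = Fin (a - b).
Proof.
move=> wx wy; have y0 : y != 0 by apply/eqP => /(val_eqoo w); rewrite wy.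
have := Defs.valM w (x / y) y; rewrite divfK // wx wy.
by case: (w (x / y)) => //= c [->]; rewrite addrK.
Qed.

Section WeaklyDistinguished.
Variables (K E : fieldType) (G : orderedAbGroupType) (i : {rmorphism K -> E}).
Variables (v : valuation K G) (w : valuation E G).
Hypothesis ext : val_extends i v w.
Variable z : E.
Hypothesis zK : forall c, z <> i c.
Hypothesis newton_z : newton_approx w i z.

Let no_best : no_best_approx w i z := newton_no_best zK newton_z.

Lemma diff_value c : exists2 k, k != 0 & w (z - i c) = w (i k).
Proof.
have [c' lt_cc'] := no_best c; have eqw := val_swap lt_cc'.
exists (c' - c); last by rewrite rmorphB eqw.
rewrite -(fmorph_eq0 i) rmorphB; apply: (val_lt_neq0 (w := w)).
by rewrite eqw; apply: lt_cc'.
Qed.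

(** The distances of z to K are an initial segment of the value group. *)
Lemma diff_initial k c : w (i k) < w (z - i c) ->
  exists c', w (z - i c') = w (i k).
Proof.
move=> lt_k; exists (c + k); rewrite rmorphD opprD addrA addrC.
by rewrite valD_lt valN.
Qed.

(** The subgroup consists of the values g with |g| <= w (z - c) - w d for some c
with w (z - c) > w d; doubling the bound makes it closed under addition. Its
coset of w (z - c0), for any c0 such that w (z - c0) > w d, is cofinal. *)
Lemma newton_weakly_distinguished : weakly_distinguished i v w z.
Proof.
have [d [[c0 dc0] step]] := newton_z; have d0 := val_lt_neq0 dc0.
pose D : set G := [set g | exists e c, [/\ v e = Fin g, w d < w (z - i c),
  w (d * i e) <= w (z - i c) & w d <= w (i e * (z - i c))]]%classic.
have double c : w d < w (z - i c) -> exists c',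
    w d < w (z - i c') /\ w ((z - i c) ^+ 2) <= w (d * (z - i c')).
  move=> dc; have [c' le_c'] := step c dc; exists c'; split=> //.
  apply: (lt_trans (dc)); rewrite -(ltr_val2l w _ _ d0).
  apply: lt_le_trans le_c'.
  by rewrite expr2 ltr_val2r // (subu_neq0 no_best).
have fin_neq0 e g : v e = Fin g -> i e != 0.
  by move=> ve; rewrite fmorph_eq0; apply/eqP => /(val_eqoo v); rewrite ve.
have common c1 c2 : w d < w (z - i c1) -> w d < w (z - i c2) -> exists c,
    [/\ w d < w (z - i c), w (z - i c1) <= w (z - i c) &
        w (z - i c2) <= w (z - i c)].
  move=> d1 d2; have [c [le1 le2]] := closer_max w i z c1 c2.
  by exists c; split=> //; apply: lt_le_trans le1.
have [k0 k00 wk0] := diff_value c0.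
have ik00 : i k0 != 0 by rewrite fmorph_eq0.
have [a va] : exists a, v k0 = Fin a by rewrite -ext; apply: val_fin.
have quotient c k g : w (z - i c) = w (i k) -> w (i k0) <= w (i k) ->
    v k = Fin g -> D (g - a).
  move=> wk le_k vk; exists (k / k0), c; rewrite (val_divE vk va) fmorph_div.
  have dk0 : w d < w (i k0) by rewrite -wk0.
  rewrite wk; split=> //; first exact: lt_le_trans dk0 le_k.
    rewrite -(ler_val2r w _ _ ik00) mulrA divfK // mulrC.
    by apply/val_mul2l_le/ltW.
  rewrite -(ler_val2r w _ _ ik00) mulrAC divfK // [d * _]mulrC.
  by apply: ler_valM => //; rewrite wk; apply: le_trans (ltW dk0) le_k.
exists D; split.
- split=> [g [e [c [ve _ _ _]]]||g h|g1 g2 g3].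
  + by exists e.
  + have := quotient c0 k0 a wk0 (lexx _) va; by rewrite subrr.
  + move=> [e1 [c1 [ve1 dc1 le1 ge1]]] [e2 [c2 [ve2 dc2 le2 ge2]]].
    have [c [dc le_c1 le_c2]] := common c1 c2 dc1 dc2.
    have [c' [dc' le_c']] := double c dc.
    have e20 := fin_neq0 _ _ ve2; have de20 : d * i e2 != 0 by rewrite mulf_neq0.
    exists (e1 / e2), c'; rewrite (val_divE ve1 ve2) fmorph_div; split=> //.
      rewrite -(ler_val2r w _ _ de20).
      have -> : d * (i e1 / i e2) * (d * i e2) = d * i e1 * d by field.
      apply: le_trans (ler_valM (le_trans le1 le_c1)
        (le_trans ge2 (val_mul2l_le _ le_c2))) _.
      have -> : (z - i c) * (i e2 * (z - i c)) = i e2 * (z - i c) ^+ 2 by ring.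
      have -> : (z - i c') * (d * i e2) = i e2 * (d * (z - i c')) by ring.
      exact: val_mul2l_le.
    rewrite -(ler_val2r w _ _ de20).
    have -> : i e1 / i e2 * (z - i c') * (d * i e2) = i e1 * (d * (z - i c')).
      by field.
    apply: le_trans (ler_valM (le_trans ge1 (val_mul2l_le _ le_c1))
      (le_trans le2 le_c2)) _.
    by rewrite -mulrA -expr2; apply: val_mul2l_le.
  + move=> [e1 [c1 [ve1 dc1 _ ge1]]] [e3 [c3 [ve3 dc3 le3 _]]] [e2 ve2] le12 le23.
    have [c [dc le_c1 le_c3]] := common c1 c3 dc1 dc3.
    have w12 : w (i e1) <= w (i e2) by rewrite !ext ve1 ve2.
    have w23 : w (i e2) <= w (i e3) by rewrite !ext ve2 ve3.
    exists e2, c; split=> //.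
      by apply: le_trans le_c3; apply: le_trans le3; apply: val_mul2l_le.
    by apply: le_trans ge1 _; apply: ler_valM.
- have [c1 lt01] := no_best c0; have [k1 k10 wk1] := diff_value c1.
  have [b vb] : exists b, v k1 = Fin b.
    by rewrite -ext; apply: val_fin; rewrite fmorph_eq0.
  have lt_k : w (i k0) < w (i k1) by rewrite -wk0 -wk1.
  exists (b - a); first exact: quotient wk1 (ltW lt_k) vb.
  rewrite subr_eq0; apply: contraTneq lt_k => ba.
  by rewrite !ext va vb ba ltxx.
exists a; first by exists k0.
split=> [g [e [c [ve dc le_e _]]]|].
  have [c1 [dc1 le01 le_c1]] := common c0 c dc0 dc.
  have [c2 [dc2 le_c2]] := double c1 dc1.
  have [c3 lt_c3] := no_best c2.
  have [|c4 wc4] := @diff_initial (k0 * e) c3.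
    apply: le_lt_trans lt_c3; rewrite -(ler_val2l w _ _ d0).
    apply: le_trans le_c2; rewrite rmorphM mulrCA expr2.
    by apply: ler_valM; [rewrite -wk0|apply: le_trans le_c1].
  by exists c4; rewrite // wc4 ext Defs.valM va ve.
move=> _ [c _ <-].
have [le_c0|lt_c] := leP (w (z - i c)) (w (z - i c0)).
  exists 0; first by have := quotient c0 k0 a wk0 (lexx _) va; rewrite subrr.
  by rewrite addr0 -va -ext -wk0.
have [k k1 wk] := diff_value c.
have [g vg] : exists g, v k = Fin g.
  by rewrite -ext; apply: val_fin; rewrite fmorph_eq0.
exists (g - a); first by apply: (quotient c k g wk _ vg); rewrite -wk0 -wk ltW.
by rewrite [a + _]addrC subrK wk ext vg.
Qed.

End WeaklyDistinguished.

Theorem theorem1p1 (K : fieldType) (G : orderedAbGroupType) (v : valuation K G)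
  (Kt : closedFieldType) (iota : {rmorphism K -> Kt})
  (alg : forall x : Kt, algebraicOver iota x)
  (w : valuation Kt G) (ext : val_extends iota v w) :
  (forall a : henselization iota w,
     (forall c : K, a <> hens_base iota w c) ->
     weakly_distinguished (hens_base iota w) v (hens_val iota w) a) /\
  immediate (hens_val_extends ext).
Proof.
have notinK (a : henselization iota w) : (forall c, a <> hens_base iota w c) ->
    forall c, hens_incl a <> iota c.
  by move=> aK c ac; apply: (aK c); apply: val_inj; apply: val_inj.
have approx (a : henselization iota w) : exists c, forall g,
    Fin g <= w (hens_incl a) -> Fin g < w (hens_incl a - iota c).
  have [[c ->]|aK] := pselect (exists c, a = hens_base iota w c).
    by exists c => g _; rewrite subrr val0.
  have [c lt_c] : exists c, w (hens_incl a - iota 0) < w (hens_incl a - iota c).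
    apply: newton_no_best (henselization_newton alg a) 0.
    by apply: notinK => c ac; apply: aK; exists c.
  by exists c => g le_g; rewrite rmorph0 subr0 in lt_c; apply: le_lt_trans lt_c.
split=> [a aK|].
  (* The sets of distances are the same in K^h and in the algebraic closure. *)
  have : weakly_distinguished iota v w (hens_incl a).
    apply: newton_weakly_distinguished => //; first exact: notinK.
    exact: henselization_newton.
  by [].
split=> [g [a ag]|].
  have {}ag : w (hens_incl a) = Fin g by [].
  have [c /(_ g)] := approx a; rewrite ag lexx => /(_ isT) lt_c.
  exists c; rewrite -ext -ag -[iota c]subr0 -[hens_incl a]subr0.
  by apply: val_swap; rewrite subr0 ag.
elim/quotW => x; have [c /(_ 0 (valP x)) lt_c] := approx (val x).
have vc : val_ring_pred v c.
  have cE : iota c = hens_incl (val x) - (hens_incl (val x) - iota c) by ring.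
  rewrite /val_ring_pred -ext cE.
  by apply: valB_ge; [apply: (valP x)|apply: ltW].
exists (residue (ValRing vc)); rewrite residue_mapE.
by apply/residue_eq; rewrite -[X in _ < X]valN opprB.
Qed.
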